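(* Let $G$ be a finite group, let $L \leq G$ be a perfect subgroup and let $e_L \in A(G)$ be the corresponding primitive idempotent. Then the following hold: (i) The admissible sets for $e_L$ assemble into an indexing system $\mathcal{I}_L$ such that $A(-)[e_L^{-1}]$ is an $\mathcal{I}_L$-Tambara functor under $A(-)$. (ii) In the poset of indexing systems, $\mathcal{I}_L$ is maximal among the elements that satisfy (i), i.e. among the indexing systems $\mathcal{J}$ such that $A(-)[e_L^{-1}]$ is a $\mathcal{J}$-Tambara functor under $A(-)$. (iii) The map $A(-) \to A(-)[e_L^{-1}]$ is a localization at $e_L$ in the category of $\mathcal{I}_L$-Tambara functors.
   Context: For $H \leq G$, $A(H)$ is the Burnside ring of finite $H$-sets. $A(-)$ is a Tambara functor with restrictions $R^H_K$, transfers $T_K^H$ and norms $N_K^H$ given by restriction, induction and co-induction $X\mapsto\mathrm{Map}_K(H,X)$. For $Q\leq G$ the mark $\phi^Q\colon A(G)\to\mathbb{Z}$ is the ring homomorphism with $\phi^Q([S])=|S^Q|$. For a finite group $Q$, $O^{\mathrm{solv}}(Q)$ is the unique minimal normal subgroup with solvable quotient; $Q$ is perfect iff $Q=O^{\mathrm{solv}}(Q)$. By Dress, conjugacy classes of perfect subgroups $L\le G$ correspond bijectively to primitive idempotents $e_L\in A(G)$, where $\phi^Q(e_L)=1$ if $O^{\mathrm{solv}}(Q)$ is conjugate in $G$ to $L$, and $0$ otherwise. $A(-)[e_L^{-1}]$ is the levelwise localization, with value $A(H)[R^G_H(e_L)^{-1}]$ at $H\leq G$; it is a Green ring (Mackey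 functor with commutative ring values, restrictions ring maps, transfers module maps over the target). Admissible sets for $e_L$: for $K\le H\le G$, the $H$-set $H/K$ is admissible for $e_L$ if ($\star$) every $L'\leq H$ that is conjugate in $G$ to $L$ is contained in $K$. A finite $H$-set is admissible if all of its orbits are. Indexing system: a contravariant functor $\mathcal{I}$ from the orbit category of $G$ to symmetric monoidal categories and strong symmetric monoidal functors, $G/H\mapsto\mathcal{I}(H)$, which is a subfunctor of $G/H\mapsto \mathcal{S}et^H$ (finite $H$-sets under disjoint union, with restriction and conjugation functors), such that (1) $\mathcal{I}(H)$ is a full symmetric monoidal subcategory of $\mathcal{S}et^H$ containing all trivial $H$-sets; (2) each $\mathcal{I}(H)$ is closed under finite limits; (3) if $H/K\in\mathcal{I}(H)$ and $T\in\mathcal{I}(K)$ then $H\times_K T\in\mathcal{I}(H)$. Indexing systems form a poset under inclusion. Incomplete Tambara functors: the category of bispans has as objects finite $G$-sets and as morphisms isomorphism classes of diagrams $X\leftarrow Y\to Z\to W$ of finite $G$-sets (encoding a restriction, then a norm, then a transfer), with the usual composition used to define Tambara functors. For an indexing system $\mathcal{I}$, let $\mathcal{S}et^G_{\mathcal{I}}$ be the category of finite $G$-sets and maps $f\colon Y\to Z$ such that $G_{f(y)}/G_y\in\mathcal{I}(G_{f(y)})$ for all $y\in Y$ (with $G_y$ the stabilizer). The bispans whose middle map $Y\to Z$ lies in $\mathcal{S}et^G_{\mathcal{I}}$ form a subcategory. An $\mathcal{I}$-Tambara functor is a product-preserving functor from this subcategory to sets whose values are abelian groups under the addition induced by transfers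 along fold maps; morphisms are natural transformations. A Tambara functor is an $\mathcal{I}$-Tambara functor for every $\mathcal{I}$ by forgetting norms. ''$A(-)[e_L^{-1}]$ is a $\mathcal{J}$-Tambara functor under $A(-)$'' means that the Green ring $A(-)[e_L^{-1}]$ has a $\mathcal{J}$-Tambara functor structure for which the canonical map $A(-)\to A(-)[e_L^{-1}]$ is a map of $\mathcal{J}$-Tambara functors (so its norms are inherited from $A(-)$). ''Localization at $e_L$ in the category of $\mathcal{I}_L$-Tambara functors'' means that the map is initial among maps of $\mathcal{I}_L$-Tambara functors $A(-)\to \underline{R}$ for which the image of $e_L$ in $\underline{R}(G)$ is a unit. *)

(* Defs.v *)
From HB Require Import structures.
From mathcomp Require Import all_boot all_order all_algebra all_fingroup all_solvable.
From mathcomp Require Import ring boolp.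

Set Implicit Arguments.
Unset Strict Implicit.
Unset Printing Implicit Defensive.

Import GRing.Theory GroupScope.

(* Throughout, the ambient finite group G is the whole of gT, and H, K range   *)
(* over its subgroups. Following the library, H-sets carry right actions;      *)
(* letting h act as h^-1 turns them into left H-sets. Accordingly the orbit    *)
(* H/K is the set of right cosets of K in H, the stabilizer of the coset K     *)
(* being K itself, and G/K -> G/H exists when K is contained in a conjugate    *)
(* of H, as for left cosets.                                                   *)

Section HSets.
Variable gT : finGroupType.
Implicit Types H K : {group gT}.

Record hset H := HSet { hs_sort :> finType; hs_act : action H hs_sort }.

Record hmap H (X Y : hset H) := HMap {
  hm_fun :> X -> Y;
  hm_equiv : forall x h, h \in H ->
    hm_fun (hs_act X x h) = hs_act Y (hm_fun x) h }.

Definition hiso H (X Y : hset H) : Prop := exists f : hmap X Y, bijective f.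

(* An action of H is a function on all of gT whose values outside H are only   *)
(* required to be injective; mk_hset lets the elements outside H act           *)
(* trivially.                                                                  *)
Section Build.
Variables (H : {group gT}) (T : finType) (op : T -> gT -> T).
Hypotheses (op1 : forall x, op x 1 = x)
  (opM : forall x, {in H &, forall a b, op x (a * b) = op (op x a) b}).

Definition on_group x a := if a \in H then op x a else x.

Lemma on_group_is_action : is_action H on_group.
Proof.
split=> [a x y|x a b Ha Hb]; rewrite /on_group; last first.
  by rewrite groupM // Ha Hb opM.
case: ifP => // Ha e.
by rewrite -[x]op1 -[y]op1 -(mulgV a) !opM ?groupV // e.
Qed.

Definition mk_hset := HSet (Action on_group_is_action).

Lemma mk_hsetE (x : mk_hset) a : a \in H -> hs_act mk_hset x a = op x a.
Proof. by move=> Ha; rewrite /= /on_group Ha. Qed.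
End Build.

Lemma hs_act1 H (X : hset H) (x : X) : hs_act X x 1 = x.
Proof. exact: act1. Qed.

Lemma hs_actM H (X : hset H) (x : X) :
  {in H &, forall a b, hs_act X x (a * b) = hs_act X (hs_act X x a) b}.
Proof. by move=> a b Ha Hb; rewrite actMin. Qed.

Section Sub.
Variables (H : {group gT}) (X : hset H) (P : pred X).
Hypothesis stableP : forall x h, h \in H -> P x -> P (hs_act X x h).

Definition sub_op (u : {x : X | P x}) a : {x : X | P x} :=
  insubd u (hs_act X (val u) a).

Lemma val_sub_op u a : a \in H -> val (sub_op u a) = hs_act X (val u) a.
Proof. by move=> Ha; rewrite val_insubd stableP ?(valP u). Qed.

Lemma sub_op1 u : sub_op u 1 = u.
Proof. by apply: val_inj; rewrite val_sub_op // hs_act1. Qed.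

Lemma sub_opM u : {in H &, forall a b, sub_op u (a * b) = sub_op (sub_op u a) b}.
Proof.
by move=> a b Ha Hb; apply: val_inj; rewrite !val_sub_op ?groupM // hs_actM.
Qed.

Definition sub_hset := mk_hset sub_op1 sub_opM.

Lemma val_sub_act (u : sub_hset) a :
  a \in H -> val (hs_act sub_hset u a) = hs_act X (val u) a.
Proof. by move=> Ha; rewrite mk_hsetE // val_sub_op. Qed.
End Sub.

Definition triv_op (T : finType) (x : T) (_ : gT) := x.
Definition triv_hset H (T : finType) : hset H :=
  @mk_hset H T (@triv_op T) (fun=> erefl) (fun _ _ _ _ _ => erefl).

Section Sum.
Variables (H : {group gT}) (X Y : hset H).
Definition sum_op (u : X + Y) a : X + Y :=
  match u with
  | inl x => inl (hs_act X x a)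
  | inr y => inr (hs_act Y y a)
  end.
Lemma sum_op1 u : sum_op u 1 = u.
Proof. by case: u => u /=; rewrite hs_act1. Qed.
Lemma sum_opM u : {in H &, forall a b, sum_op u (a * b) = sum_op (sum_op u a) b}.
Proof. by case: u => u a b Ha Hb /=; rewrite hs_actM. Qed.
Definition sum_hset := mk_hset sum_op1 sum_opM.
End Sum.

Section Prod.
Variables (H : {group gT}) (X Y : hset H).
Definition prod_op (u : X * Y) a : X * Y := (hs_act X u.1 a, hs_act Y u.2 a).
Lemma prod_op1 u : prod_op u 1 = u.
Proof. by case: u => x y; rewrite /prod_op /= !hs_act1. Qed.
Lemma prod_opM u : {in H &, forall a b, prod_op u (a * b) = prod_op (prod_op u a) b}.
Proof. by move=> a b Ha Hb; rewrite /prod_op /= !hs_actM. Qed.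
Definition prod_hset := mk_hset prod_op1 prod_opM.
Lemma prod_actE (u : prod_hset) a : a \in H ->
  hs_act prod_hset u a = (hs_act X u.1 a, hs_act Y u.2 a).
Proof. exact: mk_hsetE. Qed.
End Prod.

(* The limit of a diagram of H-sets indexed by a finite graph, with vertices J *)
(* and edges E; the limit of a diagram indexed by a finite category is that of *)
(* its underlying graph.                                                       *)
Section Lim.
Variables (H : {group gT}) (J E : finType) (D : J -> hset H) (s t : E -> J).
Variable f : forall a, hmap (D (s a)) (D (t a)).

Definition fam_op (u : {dffun forall j, D j}) h : {dffun forall j, D j} :=
  [ffun j => hs_act (D j) (u j) h].
Lemma fam_op1 u : fam_op u 1 = u.
Proof. by apply/ffunP=> j; rewrite ffunE hs_act1. Qed.
Lemma fam_opM u : {in H &, forall a b, fam_op u (a * b) = fam_op (fam_op u a) b}.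
Proof. by move=> a b Ha Hb; apply/ffunP=> j; rewrite !ffunE hs_actM. Qed.
Definition fam_hset := mk_hset fam_op1 fam_opM.

Definition compat (u : fam_hset) := [forall a, f a (u (s a)) == u (t a)].
Lemma compat_stable u h : h \in H -> compat u -> compat (hs_act fam_hset u h).
Proof.
move=> Hh /forallP uP; apply/forallP=> a.
by rewrite mk_hsetE // !ffunE hm_equiv // (eqP (uP a)).
Qed.
Definition lim_hset := sub_hset compat_stable.
Lemma val_lim_act (u : lim_hset) h : h \in H ->
  val (hs_act lim_hset u h) = [ffun j => hs_act (D j) (val u j) h].
Proof. by move=> Hh; rewrite val_sub_act // mk_hsetE. Qed.
End Lim.

Definition res_hset H K (sKH : K \subset H) (X : hset H) : hset K :=
  HSet (hs_act X \ sKH)%act.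

(* The conjugation functor from H-sets to (H :^ g)-sets: k acts as g k g^-1.   *)
Section Conj.
Variables (H : {group gT}) (g : gT) (X : hset H).
Definition conj_op (x : X) a := hs_act X x (a ^ g^-1).
Lemma conj_op1 x : conj_op x 1 = x.
Proof. by rewrite /conj_op conj1g hs_act1. Qed.
Lemma conj_opM x : {in (H :^ g)%G &, forall a b,
  conj_op x (a * b) = conj_op (conj_op x a) b}.
Proof.
by move=> a b; rewrite !mem_conjg => Ha Hb; rewrite /conj_op conjMg hs_actM.
Qed.
Definition conj_hset : hset (H :^ g)%G := mk_hset conj_op1 conj_opM.
End Conj.

Section Quo.
Variables H K : {group gT}.
Definition quo_op (u : {A : {set gT} | A \in rcosets K H}) a :
    {A : {set gT} | A \in rcosets K H} :=
  insubd u (val u :* a).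
Lemma val_quo_op u a : a \in H -> val (quo_op u a) = val u :* a.
Proof.
move=> Ha; rewrite val_insubd; case: u => A /= /rcosetsP[b Hb ->].
by rewrite -rcosetM (introT rcosetsP) //; exists (b * a); rewrite ?groupM.
Qed.
Lemma quo_op1 u : quo_op u 1 = u.
Proof. by apply: val_inj; rewrite val_quo_op // mulg1. Qed.
Lemma quo_opM u : {in H &, forall a b, quo_op u (a * b) = quo_op (quo_op u a) b}.
Proof.
by move=> a b Ha Hb; apply: val_inj; rewrite !val_quo_op ?groupM // rcosetM.
Qed.
Definition quo := mk_hset quo_op1 quo_opM.
Lemma val_quo_act (u : quo) a : a \in H -> val (hs_act quo u a) = val u :* a.
Proof. by move=> Ha; rewrite mk_hsetE // val_quo_op. Qed.
End Quo.

(* H x_K X, written X x_K H for right actions: the quotient of X * H by        *)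
(* (x, h) ~ (x k, k^-1 h), whose points are represented as equivalence classes.*)
Section Ind.
Variables (H K : {group gT}) (X : hset K).

Definition ind_cls (x : X) h : {set X * gT} :=
  [set (hs_act X x k, k^-1 * h) | k in K].
Definition is_ind_cls (S : {set X * gT}) :=
  [exists x : X, exists h in H, S == ind_cls x h].
Definition ind_shift (S : {set X * gT}) h : {set X * gT} :=
  [set (p.1, p.2 * h) | p in S].
Definition ind_op (u : {S | is_ind_cls S}) a : {S | is_ind_cls S} :=
  insubd u (ind_shift (val u) a).

Lemma ind_shift_cls x h a : ind_shift (ind_cls x h) a = ind_cls x (h * a).
Proof.
by rewrite /ind_shift /ind_cls -imset_comp; apply: eq_imset => k /=; rewrite mulgA.
Qed.
Lemma val_ind_op u a : a \in H -> val (ind_op u a) = ind_shift (val u) a.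
Proof.
move=> Ha; rewrite val_insubd ifT //; case: u => S /=.
case/existsP=> x /existsP[h /andP[Hh /eqP->]]; rewrite ind_shift_cls.
by apply/existsP; exists x; apply/existsP; exists (h * a); rewrite groupM //=.
Qed.
Lemma ind_op1 u : ind_op u 1 = u.
Proof.
apply: val_inj; rewrite val_ind_op //; case: u => S /=.
by case/existsP=> x /existsP[h /andP[Hh /eqP->]]; rewrite ind_shift_cls mulg1.
Qed.
Lemma ind_opM u : {in H &, forall a b, ind_op u (a * b) = ind_op (ind_op u a) b}.
Proof.
move=> a b Ha Hb; apply: val_inj; rewrite !val_ind_op ?groupM //; case: u => S /=.
case/existsP=> x /existsP[h /andP[Hh /eqP->]].
by rewrite !ind_shift_cls mulgA.
Qed.
Definition ind_hset := mk_hset ind_op1 ind_opM.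
End Ind.

(* Map_K(H, X): the functions f on H with f (x k) = f x . k for k in K, on     *)
(* which H acts by (f . h) x = f (h x).                                        *)
Section Coind.
Variables (H K : {group gT}) (X : hset K).

Definition transl_op (f : {ffun subg_of H -> X}) h : {ffun subg_of H -> X} :=
  [ffun x => f (subg H h * x)].
Lemma transl_op1 f : transl_op f 1 = f.
Proof. by apply/ffunP=> x; rewrite ffunE morph1 mul1g. Qed.
Lemma transl_opM f :
  {in H &, forall a b, transl_op f (a * b) = transl_op (transl_op f a) b}.
Proof.
by move=> a b Ha Hb; apply/ffunP=> x; rewrite !ffunE subgM // mulgA.
Qed.
Definition transl_hset := mk_hset transl_op1 transl_opM.

Definition is_coind (f : transl_hset) :=
  [forall x, [forall k in K, f (x * subg H k) == hs_act X (f x) k]].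
Lemma coind_stable f h : h \in H -> is_coind f -> is_coind (hs_act transl_hset f h).
Proof.
move=> Hh /forallP fP; apply/forallP=> x; apply/forall_inP=> k Kk.
by rewrite mk_hsetE // !ffunE mulgA (eqP (forall_inP (fP _) k Kk)).
Qed.
Definition coind_hset := sub_hset coind_stable.
End Coind.
End HSets.

Section Indexing.
Variable gT : finGroupType.

(* A full subfunctor of H |-> Set^H on the orbit category of G is a class of   *)
(* H-sets for each H, closed under the restriction and the conjugation         *)
(* functors, which generate the contravariant action of the orbit category.    *)
(* Subcategories are understood to be closed under isomorphism.                *)
Record indexing_system := IndexingSystem {
  ix_mem :> forall H : {group gT}, hset H -> Prop;
  ix_iso : forall H (X Y : hset H), hiso X Y -> ix_mem X -> ix_mem Y;
  ix_res : forall (H K : {group gT}) (sKH : K \subset H) (X : hset H),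
    ix_mem X -> ix_mem (res_hset sKH X);
  ix_conj : forall (H : {group gT}) (g : gT) (X : hset H),
    ix_mem X -> ix_mem (conj_hset g X);
  ix_triv : forall (H : {group gT}) (T : finType), ix_mem (triv_hset H T);
  ix_sum : forall H (X Y : hset H), ix_mem X -> ix_mem Y -> ix_mem (sum_hset X Y);
  ix_lim : forall H (J E : finType) (D : J -> hset H) (s t : E -> J)
      (f : forall a, hmap (D (s a)) (D (t a))),
    (forall j, ix_mem (D j)) -> ix_mem (lim_hset f);
  ix_ind : forall (H K : {group gT}) (X : hset K), K \subset H ->
    ix_mem (quo H K) -> ix_mem X -> ix_mem (ind_hset H X) }.

Definition ix_le (I J : indexing_system) : Prop :=
  forall H (X : hset H), I H X -> J H X.

Definition full_indexing : indexing_system.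
Proof. by exists (fun _ _ => True). Defined.

Lemma ix_le_full I : ix_le I full_indexing.
Proof. by []. Qed.

Lemma hiso_sym (H : {group gT}) (X Y : hset H) : hiso X Y -> hiso Y X.
Proof.
case=> f [g fK gK].
have eg y h : h \in H -> g (hs_act Y y h) = hs_act X (g y) h.
  by move=> Hh; rewrite -{1}[y]gK -hm_equiv // fK.
by exists (HMap eg); exists f.
Qed.

Definition stab (H : {group gT}) (X : hset H) (x : X) : {group gT} :=
  'C_H[x | hs_act X]%G.

Lemma stabP (H : {group gT}) (X : hset H) (x : X) h :
  reflect (h \in H /\ hs_act X x h = x) (h \in stab x).
Proof.
rewrite /stab !inE sub1set inE; apply: (iffP and3P) => [[Hh _ /eqP]|[Hh /eqP]] //.
Qed.

Lemma rcoset_in (H K : {group gT}) h : h \in H -> K :* h \in rcosets K H.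
Proof. by move=> Hh; apply/rcosetsP; exists h. Qed.

Definition coset_pt (H K : {group gT}) h (Hh : h \in H) : quo H K :=
  exist (fun A : {set gT} => A \in rcosets K H) (K :* h) (rcoset_in K Hh).

Lemma coset_ptP (H K : {group gT}) (A : quo H K) :
  exists h, exists Hh : h \in H, A = coset_pt K Hh.
Proof.
case: A => S Sin; case/rcosetsP: (Sin) => h Hh e.
by exists h, Hh; apply: val_inj.
Qed.

Lemma coset_pt_act (H K : {group gT}) h a (Hh : h \in H) (Ha : a \in H) :
  hs_act (quo H K) (coset_pt K Hh) a = coset_pt K (groupM Hh Ha).
Proof. by apply: val_inj; rewrite mk_hsetE // val_quo_op //= rcosetM. Qed.

Section QuoIso.
Variables (H K : {group gT}) (X : hset H) (x : X).
Hypotheses (trX : forall y : X, exists2 h, h \in H & y = hs_act X x h)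
  (stK : stab x = K :> {set gT}).

Let f (A : quo H K) : X := hs_act X x (fingroup.repr (val A)).

Lemma quo_iso_eq a b : a \in H -> b \in H ->
  (hs_act X x a == hs_act X x b) = (a \in K :* b).
Proof.
move=> Ha Hb; rewrite mem_rcoset -stK; apply/eqP/stabP => [e|[Hab e]].
  by rewrite hs_actM ?groupV // e -hs_actM ?groupV // mulgV hs_act1 groupM ?groupV.
by rewrite -{2}e -hs_actM // mulgKV.
Qed.

Let sKH : K \subset H.
Proof. by rewrite -stK subsetIl. Qed.

Let fE (A : quo H K) h : h \in H -> val A = K :* h -> f A = hs_act X x h.
Proof.
move=> Hh e; rewrite /f e; apply/eqP; rewrite quo_iso_eq ?mem_repr_rcoset //.
have := mem_repr_rcoset K h; rewrite mem_rcoset => Kr.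
by rewrite -(groupMr _ (groupVr Hh)) (subsetP sKH).
Qed.

Lemma quo_iso : hiso (quo H K) X.
Proof.
have eqf (A : quo H K) h : h \in H -> f (hs_act (quo H K) A h) = hs_act X (f A) h.
  have [b [Hb ->]] := coset_ptP A => Hh.
  by rewrite coset_pt_act (fE (groupM Hb Hh)) // (fE Hb) // hs_actM.
exists (HMap eqf).
have gin y : {A : quo H K | f A = y}.
  have [h /andP[Hh /eqP e]] : {h | (h \in H) && (y == hs_act X x h)}.
    by apply/sigW; have [h Hh ->] := trX y; exists h; rewrite Hh eqxx.
  by exists (coset_pt K Hh); rewrite (fE Hh).
exists (fun y => sval (gin y)) => [A|y] /=; last by case: (gin y).
case: (gin _) => B /=.
have [a [Ha ->]] := coset_ptP A; have [b [Hb ->]] := coset_ptP B.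
rewrite (@fE (coset_pt K Ha) a) // (@fE (coset_pt K Hb) b) // => /eqP.
by rewrite quo_iso_eq // => /rcoset_eqP e; apply: val_inj.
Qed.
End QuoIso.

Variable I : indexing_system.


Lemma ix_self (H : {group gT}) : I H (quo H H).
Proof.
apply: (ix_iso _ (ix_triv I H unit)).
have all1 (A : quo H H) : A = coset_pt H (group1 H).
  have [h [Hh ->]] := coset_ptP A; apply: val_inj => /=.
  by rewrite !rcoset_id.
have eqf (x : triv_hset H unit) h : h \in H ->
    coset_pt H (group1 H) = hs_act (quo H H) (coset_pt H (group1 H)) h.
  by move=> _; rewrite [RHS]all1.
by exists (HMap eqf); exists (fun=> tt) => [[]|A] //=; rewrite [RHS]all1.
Qed.

Section SubOrbit.
Variables (H : {group gT}) (X : hset H) (x : X).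

Let D (b : bool) : hset H := if b then X else triv_hset H bool.

Lemma orbit_ind_equiv (y : X) h : h \in H ->
  (hs_act X y h \in orbit (hs_act X) H x : triv_hset H bool) =
  hs_act (triv_hset H bool) (y \in orbit (hs_act X) H x) h.
Proof.
move=> Hh; rewrite mk_hsetE // /triv_op.
apply/orbitP/orbitP => [[k Hk e]|[k Hk <-]].
  by exists (k * h^-1); rewrite ?groupM ?groupV // hs_actM ?groupV //=
    [hs_act X x k]e -hs_actM ?groupV // mulgV hs_act1.
by exists (k * h); rewrite ?groupM // hs_actM.
Qed.
Lemma true_equiv (y : X) h : h \in H ->
  (true : triv_hset H bool) = hs_act (triv_hset H bool) true h.
Proof. by move=> Hh; rewrite mk_hsetE. Qed.

Lemma ix_orbit : I H X -> I H (quo H (stab x)).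
Proof.
move=> IX.
pose f (a : bool) : hmap (D ((fun=> true) a)) (D ((fun=> false) a)) :=
  if a then HMap orbit_ind_equiv else HMap true_equiv.
have IL : I H (lim_hset f).
  by apply: ix_lim => -[] //; apply: ix_triv.
have orbx : x \in orbit (hs_act X) H x.
  by apply/orbitP; exists 1; rewrite ?hs_act1.
pose u0 j : D j := match j return D j with true => x | false => true end.
pose u : fam_hset D := [ffun j => u0 j].
have cu : compat f u by apply/forallP=> -[]; rewrite /= !ffunE //=; apply/eqP.
pose p : lim_hset f := exist _ u cu.
apply: ix_iso IL; apply/hiso_sym/(@quo_iso _ _ _ p).
  move=> v; have /forallP vP := valP v.
  have:= vP false; rewrite /= => /eqP vf; have:= vP true; rewrite /= -vf => /eqP.
  move/orbitP=> [h Hh e]; exists h => //; apply: val_inj.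
  rewrite val_lim_act //; apply/ffunP=> -[]; rewrite !ffunE /=.
    by rewrite e.
  by rewrite -vf -[RHS]/(hs_act (triv_hset H bool) true h) mk_hsetE.
apply/setP=> h; apply/stabP/stabP => -[Hh e]; split=> //.
  move/(congr1 val): e; rewrite val_lim_act // => /ffunP/(_ true).
  by rewrite !ffunE.
apply: val_inj; rewrite val_lim_act //; apply/ffunP=> -[].
  by rewrite !ffunE.
by rewrite !ffunE -[LHS]/(hs_act (triv_hset H bool) true h) mk_hsetE.
Qed.
End SubOrbit.

Lemma ix_restr_orbit (H K : {group gT}) (X : hset H) (x : X) :
  K \subset H -> I H X -> I K (quo K (K :&: stab x)%G).
Proof.
move=> sKH IX.
have := ix_orbit (x : res_hset sKH X) (ix_res sKH IX).
rewrite (_ : stab _ = (K :&: stab x)%G) //; apply/group_inj/setP=> h.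
apply/stabP/setIP => [[Kh e]|[Kh /stabP[_ e]]] //.
by split=> //; apply/stabP; rewrite (subsetP sKH).
Qed.

Lemma stab_coset (H K : {group gT}) :
  K \subset H -> stab (coset_pt K (group1 H)) = K.
Proof.
move=> sKH; apply/group_inj/setP=> h; apply/stabP/idP => [[Hh]|Kh].
  move/(congr1 val); rewrite mk_hsetE // val_quo_op //= mulg1 => e.
  by rewrite -e rcoset_refl.
have Hh := subsetP sKH h Kh; split=> //; apply: val_inj.
by rewrite mk_hsetE // val_quo_op //= mulg1 rcoset_id.
Qed.

Lemma ix_restr (H K M : {group gT}) : K \subset H -> M \subset H ->
  I H (quo H M) -> I K (quo K (K :&: M)%G).
Proof.
move=> sKH sMH /(ix_restr_orbit (coset_pt M (group1 H)) sKH).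
by rewrite stab_coset.
Qed.

Lemma ix_tower (H K M : {group gT}) : M \subset K -> K \subset H ->
  I H (quo H K) -> I K (quo K M) -> I H (quo H M).
Proof.
move=> sMK sKH IHK IKM.
have Iind := ix_ind sKH IHK IKM.
have pin : is_ind_cls H (ind_cls (coset_pt M (group1 K)) 1).
  by apply/existsP; exists (coset_pt M (group1 K)); apply/existsP; exists 1; rewrite group1 /=.
pose p : ind_hset H (quo K M) := exist (@is_ind_cls _ H K (quo K M)) _ pin.
have := ix_orbit p Iind; rewrite (_ : stab p = M) //.
apply/group_inj/setP=> h; apply/stabP/idP => [[Hh]|Mh].
  move/(congr1 val); rewrite mk_hsetE // val_ind_op //= ind_shift_cls mul1g => e.
  have : (hs_act (quo K M) (coset_pt M (group1 K)) 1, 1^-1 * h) \in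
      ind_cls (coset_pt M (group1 K)) h by apply/imsetP; exists 1.
  rewrite e hs_act1 invg1 mul1g.
  case/imsetP=> k Kk ee; have [e1 eh] := (congr1 fst ee, congr1 snd ee).
  rewrite /= in e1 eh; rewrite mulg1 in eh.
  have : k \in stab (coset_pt M (group1 K)) by apply/stabP; split; [|rewrite {2}e1].
  by rewrite stab_coset // eh groupV.
have Kh := subsetP sMK h Mh; have Hh := subsetP sKH h Kh.
have /stabP[_ fixh]: h \in stab (coset_pt M (group1 K)) by rewrite stab_coset.
split=> //; apply: val_inj; rewrite mk_hsetE // val_ind_op //= ind_shift_cls mul1g.
apply/setP=> z; apply/imsetP/imsetP => -[k Kk ->].
  exists (h^-1 * k); first by rewrite groupM ?groupV.
  rewrite hs_actM ?groupV // invMg invgK mulg1; congr (_, _).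
  have /stabP[_ ->] // : h^-1 \in stab (coset_pt M (group1 K)).
  by rewrite stab_coset // groupV.
exists (h * k); first by rewrite groupM.
by rewrite hs_actM // fixh invMg mulgKV mulg1.
Qed.

End Indexing.
Arguments ix_le_full {gT} I.

Section Maps.
Variables (gT : finGroupType) (H : {group gT}).
Implicit Types X Y : hset H.

Lemma inl_equiv X Y (x : X) h : h \in H ->
  inl (hs_act X x h) = hs_act (sum_hset X Y) (inl x) h.
Proof. by move=> Hh; rewrite mk_hsetE. Qed.
Lemma inr_equiv X Y (y : Y) h : h \in H ->
  inr (hs_act Y y h) = hs_act (sum_hset X Y) (inr y) h.
Proof. by move=> Hh; rewrite mk_hsetE. Qed.
Definition hinl X Y : hmap X (sum_hset X Y) :=
  @HMap _ _ X (sum_hset X Y) inl (@inl_equiv X Y).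
Definition hinr X Y : hmap Y (sum_hset X Y) :=
  @HMap _ _ Y (sum_hset X Y) inr (@inr_equiv X Y).

Definition fold_fun X (u : sum_hset X X) : X :=
  match u with inl x => x | inr x => x end.
Lemma fold_equiv X (u : sum_hset X X) h : h \in H ->
  fold_fun (hs_act (sum_hset X X) u h) = hs_act X (fold_fun u) h.
Proof. by move=> Hh; rewrite mk_hsetE //; case: u. Qed.
Definition hfold X : hmap (sum_hset X X) X := HMap (@fold_equiv X).
End Maps.

Section Bispans.
Variable gT : finGroupType.

Definition gset := hset [set: gT]%G.
Implicit Types X Y Z W : gset.

Definition hid (H : {group gT}) (X : hset H) : hmap X X :=
  HMap (fun (x : X) h (_ : h \in H) => erefl (hs_act X x h)).

Lemma hcomp_equiv (H : {group gT}) (X Y Z : hset H) (g : hmap Y Z) (f : hmap X Y) x h :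
  h \in H -> g (f (hs_act X x h)) = hs_act Z (g (f x)) h.
Proof. by move=> Hh; rewrite !hm_equiv. Qed.
Definition hcomp H (X Y Z : hset H) (g : hmap Y Z) (f : hmap X Y) : hmap X Z :=
  HMap (hcomp_equiv g f).

(* X <-r- Y -n-> Z -t-> W: restrict along r, take norms along n, transfer      *)
(* along t.                                                                    *)
Record bispan X W := Bispan {
  bs_Y : gset;
  bs_Z : gset;
  bs_r : hmap bs_Y X;
  bs_n : hmap bs_Y bs_Z;
  bs_t : hmap bs_Z W }.

Definition bispan_iso X W (b b' : bispan X W) : Prop :=
  exists (u : hmap (bs_Y b) (bs_Y b')) (v : hmap (bs_Z b) (bs_Z b')),
    [/\ bijective u, bijective v,
        forall y, bs_r b' (u y) = bs_r b y,
        forall y, bs_n b' (u y) = v (bs_n b y) &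
        forall z, bs_t b' (v z) = bs_t b z].

Definition bs_id X : bispan X X := Bispan (hid X) (hid X) (hid X).
Definition bs_R X Y (f : hmap X Y) : bispan Y X := Bispan f (hid X) (hid X).
Definition bs_N X Y (f : hmap X Y) : bispan X Y := Bispan (hid X) f (hid Y).
Definition bs_T X Y (f : hmap X Y) : bispan X Y := Bispan (hid X) (hid X) f.

(* For b1 = (X <-r1- A -n1-> B -t1-> Y) and b2 = (Y <-r2- C -n2-> D -t2-> Z),   *)
(* the dependent product along n2 of the pullback C x_Y B is the set comp_Z of *)
(* pairs (d, s), where d is in D and s maps each c over d to some b in B with  *)
(* t1 b = r2 c; s is encoded as a partial function on C, undefined exactly     *)
(* outside the fibre over d. Over (d, s), the middle map of the composite has  *)
(* the fibre of all (a, c) such that c lies over d and n1 a = s c. This is     *)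
(* the distributive law                                                        *)
(*   prod_(c over d) sum_(b over r2 c) prod_(a over b) f (r1 a)                *)
(*     = sum_(s) prod_(c over d) prod_(a over s c) f (r1 a).                   *)
Section Comp.
Variables (X Y Z : gset) (b2 : bispan Y Z) (b1 : bispan X Y).
Local Notation A := (bs_Y b1).
Local Notation B := (bs_Z b1).
Local Notation C := (bs_Y b2).
Local Notation D := (bs_Z b2).

Definition psec_op (s : {ffun C -> option B}) h : {ffun C -> option B} :=
  [ffun c => omap (fun b => hs_act B b h) (s (hs_act C c h^-1))].
Lemma psec_op1 s : psec_op s 1 = s.
Proof.
apply/ffunP=> c; rewrite ffunE invg1 hs_act1.
by case: (s c) => //= b; rewrite hs_act1.
Qed.
Lemma psec_opM s : {in [set: gT]%G &, forall a b,
  psec_op s (a * b) = psec_op (psec_op s a) b}.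
Proof.
move=> a b _ _; apply/ffunP=> c; rewrite !ffunE invMg hs_actM ?inE //.
by case: (s _) => //= x; rewrite hs_actM ?inE.
Qed.
Definition psec_gset : gset := mk_hset psec_op1 psec_opM.
Lemma psec_actE (s : psec_gset) h :
  hs_act psec_gset s h = [ffun c => omap (fun b => hs_act B b h) (s (hs_act C c h^-1))].
Proof. by rewrite mk_hsetE ?inE. Qed.

Definition is_sec (u : prod_hset D psec_gset) :=
  [forall c, if u.2 c is Some b then (bs_n b2 c == u.1) && (bs_t b1 b == bs_r b2 c)
             else bs_n b2 c != u.1].
Lemma is_sec_stable u h : h \in [set: gT] ->
  is_sec u -> is_sec (hs_act (prod_hset D psec_gset) u h).
Proof.
move=> _ /forallP uP; apply/forallP=> c; rewrite prod_actE ?inE // psec_actE /= ffunE.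
have := uP (hs_act C c h^-1).
have cE : hs_act C (hs_act C c h^-1) h = c by rewrite -hs_actM ?inE // mulVg hs_act1.
case: (u.2 _) => [b|] /=.
  case/andP=> /eqP e1 /eqP e2.
  by rewrite -e1 -!hm_equiv ?inE // cE eqxx hm_equiv ?inE // e2 -hm_equiv ?inE // cE eqxx.
apply: contra => /eqP e; rewrite hm_equiv ?inE // e.
by rewrite -hs_actM ?inE // mulgV hs_act1.
Qed.
Definition comp_Z : gset := sub_hset is_sec_stable.
Lemma val_comp_Z_act (u : comp_Z) h :
  val (hs_act comp_Z u h) =
  (hs_act D (val u).1 h, hs_act psec_gset (val u).2 h).
Proof. by rewrite val_sub_act ?inE // prod_actE ?inE. Qed.

Definition is_eval (w : prod_hset (prod_hset A C) comp_Z) :=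
  (val w.2).2 w.1.2 == Some (bs_n b1 w.1.1).
Lemma is_eval_stable w h : h \in [set: gT] ->
  is_eval w -> is_eval (hs_act (prod_hset (prod_hset A C) comp_Z) w h).
Proof.
move=> hT; rewrite /is_eval !prod_actE //= => /eqP e.
rewrite val_comp_Z_act psec_actE ffunE.
by rewrite -hs_actM ?inE // mulgV hs_act1 e /= hm_equiv ?inE.
Qed.
Definition comp_Y : gset := sub_hset is_eval_stable.
Lemma val_comp_Y_act (w : comp_Y) h :
  val (hs_act comp_Y w h) =
  ((hs_act A (val w).1.1 h, hs_act C (val w).1.2 h), hs_act comp_Z (val w).2 h).
Proof. by rewrite val_sub_act ?inE // !prod_actE ?inE. Qed.

Lemma comp_r_equiv (w : comp_Y) h : h \in [set: gT] ->
  bs_r b1 (val (hs_act comp_Y w h)).1.1 = hs_act X (bs_r b1 (val w).1.1) h.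
Proof. by move=> hT; rewrite val_comp_Y_act /= hm_equiv. Qed.
Lemma comp_n_equiv (w : comp_Y) h : h \in [set: gT] ->
  (val (hs_act comp_Y w h)).2 = hs_act comp_Z (val w).2 h.
Proof. by move=> hT; rewrite val_comp_Y_act. Qed.
Lemma comp_t_equiv (u : comp_Z) h : h \in [set: gT] ->
  bs_t b2 (val (hs_act comp_Z u h)).1 = hs_act Z (bs_t b2 (val u).1) h.
Proof. by move=> hT; rewrite val_comp_Z_act /= hm_equiv. Qed.

Definition bs_comp : bispan X Z :=
  Bispan (HMap comp_r_equiv) (HMap comp_n_equiv) (HMap comp_t_equiv).
End Comp.

Section InSet.
Variable I : indexing_system gT.

Definition in_Set Y Z (f : hmap Y Z) : Prop :=
  forall y : Y, I (stab (f y)) (quo (stab (f y)) (stab y)).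

Lemma stab_map Y Z (f : hmap Y Z) y : stab y \subset stab (f y).
Proof.
by apply/subsetP=> h /stabP[Hh e]; apply/stabP; rewrite -hm_equiv ?e.
Qed.

Lemma in_Set_eq_stab Y Z (f : hmap Y Z) :
  (forall y, stab (f y) \subset stab y) -> in_Set f.
Proof.
move=> fP y; rewrite (_ : stab (f y) = stab y); first exact: ix_self.
by apply/group_inj/eqP; rewrite eqEsubset fP stab_map.
Qed.

Lemma in_Set_id X : in_Set (hid X).
Proof. exact: in_Set_eq_stab. Qed.

Lemma in_Set_fold X : in_Set (hfold X).
Proof.
apply: in_Set_eq_stab => -[x|x]; apply/subsetP=> h /stabP[hT e];
  by apply/stabP; split; rewrite // mk_hsetE //= [hs_act X x h]e.
Qed.

Lemma in_Set_comp X Y Z (b2 : bispan Y Z) (b1 : bispan X Y) :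
  in_Set (bs_n b2) -> in_Set (bs_n b1) -> in_Set (bs_n (bs_comp b2 b1)).
Proof.
move=> I2 I1 w; case: (w) => -[[a c] u] ev /=.
set w0 : comp_Y b2 b1 := exist (@is_eval _ _ _ b2 b1) _ ev.
have nc : bs_n b2 c = (val u).1.
  have /forallP/(_ c) := valP u; move/eqP: (ev) => /= ->.
  by case/andP=> /eqP.
have sec : (val u).2 c = Some (bs_n b1 a) by apply/eqP.
have sSd : stab u \subset stab (bs_n b2 c).
  rewrite nc; apply/subsetP=> h /stabP[hT e]; apply/stabP; split=> //.
  by rewrite -{2}e val_comp_Z_act.
have H1 := ix_restr sSd (stab_map (bs_n b2) c) (I2 c).
have sPb : (stab u :&: stab c)%G \subset stab (bs_n b1 a).
  apply/subsetP=> h /setIP[/stabP[hT e] /stabP[_ ec]]; apply/stabP; split=> //.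
  have := congr1 (fun v : comp_Z b2 b1 => (val v).2 c) e.
  rewrite val_comp_Z_act psec_actE ffunE -{1}ec.
  by rewrite -hs_actM ?inE // mulgV hs_act1 sec /= => -[].
have H2 := ix_restr sPb (stab_map (bs_n b1) a) (I1 a).
have := ix_tower (subsetIl _ _) (subsetIl _ _) H1 H2.
rewrite (_ : stab w0 = (stab u :&: stab c :&: stab a)%G) //.
apply/group_inj/setP=> h.
apply/stabP/setIP=> [[hT e]|[/setIP[/stabP[hT eu] /stabP[_ ec]] /stabP[_ ea]]].
  move/(congr1 val): e; rewrite val_comp_Y_act => e.
  split; last by apply/stabP; split=> //; apply: (congr1 (fun z => z.1.1) e).
  apply/setIP; split; apply/stabP; split=> //; last exact: (congr1 (fun z => z.1.2) e).
  exact: (congr1 (fun z => z.2) e).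
split=> //; apply: val_inj; rewrite val_comp_Y_act.
exact: (f_equal2 pair (f_equal2 pair ea ec) eu).
Qed.

Record ibispan X W := IBispan {
  ib_val :> bispan X W;
  ib_in : in_Set (bs_n ib_val) }.

Definition ib_id X : ibispan X X := @IBispan X X (bs_id X) (@in_Set_id X).
Definition ib_R X Y (f : hmap X Y) : ibispan Y X := @IBispan Y X (bs_R f) (@in_Set_id X).
Definition ib_T X Y (f : hmap X Y) : ibispan X Y := @IBispan X Y (bs_T f) (@in_Set_id X).
Definition ib_N X Y (f : hmap X Y) (If : in_Set f) : ibispan X Y :=
  @IBispan X Y (bs_N f) If.
Definition ib_comp X Y Z (b2 : ibispan Y Z) (b1 : ibispan X Y) : ibispan X Z :=
  @IBispan X Z (bs_comp b2 b1) (in_Set_comp (@ib_in _ _ b2) (@ib_in _ _ b1)).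

End InSet.
End Bispans.
Section OrbitCat.
Variable gT : finGroupType.
Implicit Types H K : {group gT}.

Definition orb H : gset gT := quo [set: gT]%G H.
Definition pt : gset gT := orb [set: gT]%G.

Section Proj.
Variables (H K : {group gT}) (sKH : K \subset H).
Lemma proj_in (A : orb K) : (H * val A)%g \in rcosets H [set: gT].
Proof.
have [h [Hh ->]] := coset_ptP A; rewrite /= mulgA mulGSid //.
exact: rcoset_in.
Qed.
Definition proj_fun (A : orb K) : orb H :=
  exist (fun B : {set gT} => B \in rcosets H [set: gT]) _ (proj_in A).
Lemma proj_equiv (A : orb K) h : h \in [set: gT]%G ->
  proj_fun (hs_act (orb K) A h) = hs_act (orb H) (proj_fun A) h.
Proof.
by move=> hT; apply: val_inj; rewrite val_quo_act //= val_quo_act // mulgA.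
Qed.
Definition orb_proj : hmap (orb K) (orb H) := HMap proj_equiv.
End Proj.

Section ConjMap.
Variables (H : {group gT}) (g : gT).
Lemma conj_coset h : g *: ((H :^ g) :* h) = H :* (g * h).
Proof. by rewrite conjsgE !mulgA mulg_set1 mulgV mul1g -mulgA mulg_set1. Qed.

Lemma conj_in (A : orb (H :^ g)%G) : g *: val A \in rcosets H [set: gT].
Proof.
by have [h [Hh ->]] := coset_ptP A; rewrite /= conj_coset rcoset_in ?inE.
Qed.
Definition conj_fun (A : orb (H :^ g)%G) : orb H :=
  exist (fun B : {set gT} => B \in rcosets H [set: gT]) _ (conj_in A).
Lemma conj_equiv (A : orb (H :^ g)%G) h : h \in [set: gT]%G ->
  conj_fun (hs_act (orb (H :^ g)%G) A h) = hs_act (orb H) (conj_fun A) h.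
Proof.
by move=> hT; apply: val_inj; rewrite val_quo_act //= val_quo_act // mulgA.
Qed.
Definition orb_conj : hmap (orb (H :^ g)%G) (orb H) := HMap conj_equiv.
End ConjMap.

Lemma to_pt_equiv (X : gset gT) (x : X) h : h \in [set: gT]%G ->
  coset_pt [set: gT]%G (group1 _) =
    hs_act pt (coset_pt [set: gT]%G (group1 [set: gT]%G)) h.
Proof.
by move=> hT; apply: val_inj; rewrite val_quo_act //= -rcosetM !rcoset_id // inE.
Qed.
Definition to_pt (X : gset gT) : hmap X pt := HMap (@to_pt_equiv X).
End OrbitCat.

Section Tambara.
Variable gT : finGroupType.
Local Open Scope ring_scope.

(* A product-preserving functor on the bispans with norms in I whose values    *)
(* are abelian groups. In that category the product of X and Y is their        *)
(* disjoint union, with projections the restrictions along the inclusions, and *)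
(* the terminal object is empty. The additive structure of tb_ob X is forced   *)
(* by tb_add to be the one induced by transfers along fold maps; its product   *)
(* is forced by tb_mul to be the one induced by norms along fold maps, which   *)
(* lie in every indexing system. The axioms of a commutative ring other than   *)
(* the existence of opposites follow from functoriality.                       *)
Record tambara (I : indexing_system gT) := Tambara {
  tb_ob :> gset gT -> comPzRingType;
  tb_map : forall X Y : gset gT, ibispan I X Y -> tb_ob X -> tb_ob Y;
  tb_iso : forall (X Y : gset gT) (b b' : ibispan I X Y),
    bispan_iso b b' -> tb_map b =1 tb_map b';
  tb_id : forall X : gset gT, tb_map (ib_id I X) =1 id;
  tb_comp : forall (X Y Z : gset gT) (b2 : ibispan I Y Z) (b1 : ibispan I X Y),
    tb_map (ib_comp b2 b1) =1 tb_map b2 \o tb_map b1;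
  tb_empty : forall a b : tb_ob (triv_hset [set: gT]%G void), a = b;
  tb_prod : forall X Y : gset gT,
    bijective (fun a : tb_ob (sum_hset X Y) =>
      (tb_map (ib_R I (hinl X Y)) a, tb_map (ib_R I (hinr X Y)) a));
  tb_add : forall (X : gset gT) (a : tb_ob (sum_hset X X)),
    tb_map (ib_T I (hfold X)) a =
    tb_map (ib_R I (hinl X X)) a + tb_map (ib_R I (hinr X X)) a;
  tb_mul : forall (X : gset gT) (a : tb_ob (sum_hset X X)),
    tb_map (ib_N (@in_Set_fold _ I X)) a =
    tb_map (ib_R I (hinl X X)) a * tb_map (ib_R I (hinr X X)) a }.

Section Forget.
Variables (I J : indexing_system gT) (leIJ : ix_le I J).

Definition ib_le (X Y : gset gT) (b : ibispan I X Y) : ibispan J X Y :=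
  @IBispan _ J X Y b (fun y => leIJ (@ib_in _ _ _ _ b y)).

Lemma bispan_iso_refl (X Y : gset gT) (b : bispan X Y) : bispan_iso b b.
Proof. by exists (hid _), (hid _); split=> //; exists id. Qed.

Variable B : tambara J.

Let mapE (X Y : gset gT) (b b' : ibispan J X Y) : ib_val b = ib_val b' ->
  @tb_map J B X Y b =1 tb_map b'.
Proof. by move=> e; apply: tb_iso; rewrite e; apply: bispan_iso_refl. Qed.

Definition tb_forget : tambara I.
Proof.
exists (tb_ob B) (fun X Y b => tb_map (ib_le b)).
- by move=> X Y b b' bb' a; apply: tb_iso.
- by move=> X a; rewrite (mapE (b' := ib_id J X)) // tb_id.
- move=> X Y Z b2 b1 a.
  by rewrite (mapE (b' := ib_comp (ib_le b2) (ib_le b1))) // tb_comp.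
- exact: tb_empty.
- move=> X Y; apply: (eq_bij (tb_prod B X Y)) => a.
  by congr (_, _); apply: mapE.
- move=> X a; rewrite (mapE (b' := ib_T J (hfold X))) // tb_add.
  by congr (_ + _); apply: mapE.
- move=> X a; rewrite (mapE (b' := ib_N (@in_Set_fold _ J X))) // tb_mul.
  by congr (_ * _); apply: mapE.
Defined.
End Forget.

(* Natural transformations; they are automatically ring morphisms, by naturality*)
(* with respect to fold maps and to the maps from the empty set.               *)
Definition tb_hom I (A B : tambara I) (f : forall X, A X -> B X) : Prop :=
  forall (X Y : gset gT) (b : ibispan I X Y) (a : A X),
    f Y (tb_map b a) = tb_map b (f X a).

End Tambara.

(* The localization R[1/x], the fraction a/x^n being represented by (a, n). The *)
(* zero ring is allowed, as R and as R[1/x].                                   *)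
Section Localization.
Local Open Scope quotient_scope.
Local Open Scope ring_scope.
Variables (R : comPzRingType) (x : R).

Definition loc_rel (p q : R * nat) : bool :=
  `[< exists k, x ^+ (k + q.2) * p.1 = x ^+ (k + p.2) * q.1 >].

Lemma loc_refl : reflexive loc_rel.
Proof. by move=> p; apply/asboolP; exists 0%N. Qed.
Lemma loc_sym : symmetric loc_rel.
Proof. by move=> p q; apply/asboolP/asboolP=> -[k e]; exists k. Qed.
Lemma loc_trans : transitive loc_rel.
Proof.
move=> [b n] [a m] [c p] /asboolP[k /= e1] /asboolP[l /= e2]; apply/asboolP => /=.
exists (k + l + n)%N.
rewrite (_ : k + l + n + p = (l + p) + (k + n))%N; last by ring.
rewrite (_ : k + l + n + m = (k + m) + (l + n))%N; last by ring.
by rewrite exprD -mulrA e1 mulrCA e2 mulrA -exprD.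
Qed.

Canonical loc_equiv := EquivRel loc_rel loc_refl loc_sym loc_trans.

Definition locring := {eq_quot loc_equiv}.
HB.instance Definition _ := Choice.on locring.
HB.instance Definition _ := EqQuotient.on locring.

Definition lfrac (p : R * nat) : locring := \pi_locring p.

Lemma lfracP (p q : R * nat) :
  reflect (exists k, x ^+ (k + q.2) * p.1 = x ^+ (k + p.2) * q.1)
          (lfrac p == lfrac q).
Proof. by rewrite /lfrac eqmodE; apply: asboolP. Qed.

Definition lrep (q : locring) : R * nat := generic_quotient.repr q.
Lemma lrepK q : lfrac (lrep q) = q.
Proof. exact: reprK. Qed.

Definition ladd (a b : locring) : locring :=
  lfrac (x ^+ (lrep b).2 * (lrep a).1 + x ^+ (lrep a).2 * (lrep b).1,
         ((lrep a).2 + (lrep b).2)%N).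
Definition lopp (a : locring) : locring := lfrac (- (lrep a).1, (lrep a).2).
Definition lmul (a b : locring) : locring :=
  lfrac ((lrep a).1 * (lrep b).1, ((lrep a).2 + (lrep b).2)%N).

Lemma lrepP p : exists k, x ^+ (k + p.2) * (lrep (lfrac p)).1 =
                          x ^+ (k + (lrep (lfrac p)).2) * p.1.
Proof. by apply/lfracP; rewrite lrepK. Qed.

Lemma laddE p q : ladd (lfrac p) (lfrac q) =
  lfrac (x ^+ q.2 * p.1 + x ^+ p.2 * q.1, (p.2 + q.2)%N).
Proof.
have [k e1] := lrepP p; have [l e2] := lrepP q; rewrite /ladd.
case: (lrep _) e1 => a m /= e1; case: (lrep _) e2 => b n /= e2.
apply/eqP/lfracP; exists (k + l)%N => /=; rewrite !mulrDr; congr (_ + _).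
  rewrite !mulrA -!exprD.
  rewrite (_ : k + l + (p.2 + q.2) + n = (l + q.2 + n) + (k + p.2))%N; last by ring.
  rewrite (_ : k + l + (m + n) + q.2 = (l + q.2 + n) + (k + m))%N; last by ring.
  by rewrite exprD -mulrA e1 mulrA -exprD.
rewrite !mulrA -!exprD.
rewrite (_ : k + l + (p.2 + q.2) + m = (k + p.2 + m) + (l + q.2))%N; last by ring.
rewrite (_ : k + l + (m + n) + p.2 = (k + p.2 + m) + (l + n))%N; last by ring.
by rewrite exprD -mulrA e2 mulrA -exprD.
Qed.

Lemma lmulE p q : lmul (lfrac p) (lfrac q) = lfrac (p.1 * q.1, (p.2 + q.2)%N).
Proof.
have [k e1] := lrepP p; have [l e2] := lrepP q; rewrite /lmul.
case: (lrep _) e1 => a m /= e1; case: (lrep _) e2 => b n /= e2.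
apply/eqP/lfracP; exists (k + l)%N => /=.
rewrite (_ : k + l + (p.2 + q.2) = (k + p.2) + (l + q.2))%N; last by ring.
rewrite (_ : k + l + (m + n) = (k + m) + (l + n))%N; last by ring.
by rewrite (exprD x (k + p.2)) (exprD x (k + m)) mulrACA e1 e2 mulrACA.
Qed.

Lemma loppE p : lopp (lfrac p) = lfrac (- p.1, p.2).
Proof.
have [k e1] := lrepP p; apply/eqP/lfracP; exists k.
by rewrite /= !mulrN e1.
Qed.

Lemma lfrac_ind (P : locring -> Prop) : (forall p, P (lfrac p)) -> forall a, P a.
Proof. by move=> PP a; rewrite -[a]lrepK. Qed.

Lemma laddA : associative ladd.
Proof.
elim/lfrac_ind=> p; elim/lfrac_ind=> q; elim/lfrac_ind=> r; rewrite !laddE /=.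
by congr lfrac; congr (_, _); [rewrite !exprD; ring | ring].
Qed.
Lemma laddC : commutative ladd.
Proof.
elim/lfrac_ind=> p; elim/lfrac_ind=> q; rewrite !laddE.
by rewrite addrC addnC.
Qed.
Lemma ladd0 : left_id (lfrac (0, 0%N)) ladd.
Proof.
elim/lfrac_ind=> -[a m]; rewrite laddE /= mulr0 add0r expr0 mul1r //.
Qed.
Lemma laddN : left_inverse (lfrac (0, 0%N)) lopp ladd.
Proof.
elim/lfrac_ind=> -[a m]; rewrite loppE laddE /= mulrN addNr.
by apply/eqP/lfracP; exists 0%N; rewrite /= !mulr0.
Qed.
HB.instance Definition _ := GRing.isZmodule.Build locring laddA laddC ladd0 laddN.

Lemma lmulA : associative lmul.
Proof.
elim/lfrac_ind=> p; elim/lfrac_ind=> q; elim/lfrac_ind=> r; rewrite !lmulE /=.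
by rewrite mulrA addnA.
Qed.
Lemma lmulC : commutative lmul.
Proof.
by elim/lfrac_ind=> p; elim/lfrac_ind=> q; rewrite !lmulE mulrC addnC.
Qed.
Lemma lmul1 : left_id (lfrac (1, 0%N)) lmul.
Proof. by elim/lfrac_ind=> -[a m]; rewrite lmulE /= mul1r. Qed.
Lemma lmulDl : left_distributive lmul ladd.
Proof.
elim/lfrac_ind=> p; elim/lfrac_ind=> q; elim/lfrac_ind=> r.
rewrite laddE !lmulE laddE /=; apply/eqP/lfracP; exists 0%N => /=.
by rewrite !exprD; ring.
Qed.
HB.instance Definition _ :=
  GRing.Zmodule_isComPzRing.Build locring lmulA lmulC lmul1 lmulDl.
End Localization.

(* a/x^n |-> f a/y^n, computed on a chosen representative. The result does not *)
(* depend on it as soon as f (x * a) = y * f a for all a, which is the case    *)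
(* when f is a restriction of a Green ring and y the restriction of x, and, by *)
(* Frobenius reciprocity, when f is a transfer and x the restriction of y.     *)
Definition loc_map (R S : comPzRingType) (x : R) (y : S) (f : R -> S)
    (q : locring x) : locring y :=
  lfrac y (f (lrep q).1, (lrep q).2).
Arguments loc_map {R S x y} f q.

(* The Green ring A(-)[1/e]: its rings loc_ob, restrictions, transfers, and the*)
(* canonical map from A. Its value at H is the one at G/H.                     *)
Section LevelwiseLocalization.
Variables (gT : finGroupType) (I : indexing_system gT) (A : tambara I) (e : A (pt gT)).
Implicit Types X Y : gset gT.
Local Open Scope ring_scope.

Definition loc_ob X : comPzRingType := locring (tb_map (ib_R I (to_pt X)) e).
Definition loc_res X Y (f : hmap X Y) : loc_ob Y -> loc_ob X :=
  loc_map (tb_map (ib_R I f)).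
Definition loc_tr X Y (f : hmap X Y) : loc_ob X -> loc_ob Y :=
  loc_map (tb_map (ib_T I f)).
Definition loc_can X (a : A X) : loc_ob X := lfrac _ (a, 0%N).

(* B, transported along the isomorphism of Green rings theta, is a J-Tambara   *)
(* structure on A(-)[1/e], and the canonical map A -> A(-)[1/e], which is eta  *)
(* up to theta, is a map of J-Tambara functors.                                *)
Definition loc_structure (J : indexing_system gT) (leJI : ix_le J I) (B : tambara J)
    (eta : forall X, A X -> B X) (theta : forall X, {rmorphism B X -> loc_ob X}) : Prop :=
  [/\ forall X, bijective (theta X),
      forall X Y (f : hmap X Y) b,
        theta X (tb_map (ib_R J f) b) = loc_res f (theta Y b),
      forall X Y (f : hmap X Y) b,
        theta Y (tb_map (ib_T J f) b) = loc_tr f (theta X b),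
      @tb_hom _ J (tb_forget leJI A) B eta &
      forall X a, theta X (eta X a) = loc_can a].

Definition has_loc_structure (J : indexing_system gT) (leJI : ix_le J I) : Prop :=
  exists (B : tambara J) (eta : forall X, A X -> B X)
         (theta : forall X, {rmorphism B X -> loc_ob X}),
    loc_structure leJI eta theta.
End LevelwiseLocalization.

Definition is_invertible (R : comPzRingType) (x : R) : Prop := exists y, (x * y = 1)%R.

Definition is_tb_localization (gT : finGroupType) (I : indexing_system gT)
    (A B : tambara I) (e : A (pt gT)) (eta : forall X, A X -> B X) : Prop :=
  [/\ tb_hom eta, is_invertible (eta (pt gT) e) &
      forall (C : tambara I) (f : forall X, A X -> C X),
        tb_hom f -> is_invertible (f (pt gT) e) ->
        exists g : forall X, B X -> C X,
          [/\ tb_hom g, forall X a, g X (eta X a) = f X a &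
              forall g' : forall X, B X -> C X, tb_hom g' ->
                (forall X a, g' X (eta X a) = f X a) -> forall X b, g' X b = g X b]].

Lemma in_Set_full (gT : finGroupType) (X Y : gset gT) (f : hmap X Y) :
  in_Set (full_indexing gT) f.
Proof. by []. Qed.

(* The Burnside Tambara functor: bt_cl exhibits the value at G/H as the        *)
(* Grothendieck ring of finite H-sets, and on the classes of H-sets the        *)
(* restrictions, transfers and norms are restriction, induction and            *)
(* co-induction. This determines the Tambara functor up to a unique            *)
(* isomorphism compatible with bt_cl; the norms of virtual H-sets are          *)
(* determined by the functoriality on bispans.                                 *)
Record burnside (gT : finGroupType) := Burnside {
  bt_tb :> tambara (full_indexing gT);
  bt_cl : forall H : {group gT}, hset H -> bt_tb (orb H);
  bt_eq : forall (H : {group gT}) (X Y : hset H),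
    bt_cl X = bt_cl Y <-> exists Z, hiso (sum_hset X Z) (sum_hset Y Z);
  bt_gen : forall (H : {group gT}) (a : bt_tb (orb H)),
    exists X Y : hset H, a = (bt_cl X - bt_cl Y)%R;
  bt_sum : forall (H : {group gT}) (X Y : hset H),
    bt_cl (sum_hset X Y) = (bt_cl X + bt_cl Y)%R;
  bt_prod : forall (H : {group gT}) (X Y : hset H),
    bt_cl (prod_hset X Y) = (bt_cl X * bt_cl Y)%R;
  bt_res : forall (H K : {group gT}) (sKH : K \subset H) (X : hset H),
    tb_map (ib_R _ (orb_proj sKH)) (bt_cl X) = bt_cl (res_hset sKH X);
  bt_conj : forall (H : {group gT}) (g : gT) (X : hset H),
    tb_map (ib_R _ (orb_conj H g)) (bt_cl X) = bt_cl (conj_hset g X);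
  bt_tr : forall (H K : {group gT}) (sKH : K \subset H) (X : hset K),
    tb_map (ib_T _ (orb_proj sKH)) (bt_cl X) = bt_cl (ind_hset H X);
  bt_norm : forall (H K : {group gT}) (sKH : K \subset H) (X : hset K),
    tb_map (ib_N (in_Set_full (orb_proj sKH))) (bt_cl X) = bt_cl (coind_hset H X) }.

Definition is_mark (gT : finGroupType) (A : burnside gT) (Q : {group gT})
    (phi : A (pt gT) -> int) : Prop :=
  forall S : hset [set: gT]%G, phi (bt_cl A S) = (#|'Fix_(hs_act S)(Q)|%:Z)%R.

Section Groups.
Variable gT : finGroupType.
Implicit Types H K L Q : {group gT}.

(* The intersection of all normal subgroups with solvable quotient is the      *)
(* smallest of them, by Osolv_solvable and Osolv_sub.                          *)
Definition Osolv Q : {set gT} :=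
  \bigcap_(N : {group gT} | (N <| Q) && solvable (Q / N)) N.
Canonical Osolv_group Q := Eval hnf in [group of Osolv Q].

Lemma Osolv_sub Q (N : {group gT}) : N <| Q -> solvable (Q / N) -> Osolv Q \subset N.
Proof. by move=> nN sN; apply: (bigcap_inf N); rewrite nN. Qed.

Lemma der_sub_le Q m n : m <= n -> Q^`(n) \subset Q^`(m).
Proof.
move=> lmn; rewrite -(subnK lmn) addnC.
by elim: (n - m) => [|k IH]; rewrite ?addn0 // addnS (subset_trans (der_subS _ _)).
Qed.

Lemma Osolv_solvable Q : Osolv Q <| Q /\ solvable (Q / Osolv Q).
Proof.
have nO : Osolv Q <| Q.
  rewrite /normal Osolv_sub ?normal_refl ?trivg_quotient ?solvable1 //=.
  by apply: norms_bigcap; apply/bigcapsP=> N /andP[/andP[]].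
split=> //; have exn (N : {group gT}) :
    {n | N <| Q -> solvable (Q / N) -> Q^`(n) \subset N}.
  have [nN|] := boolP (N <| Q); last by exists 0.
  have [solN|] := boolP (solvable (Q / N)); last by exists 0.
  have /sigW[n /eqP e] : exists n, (Q / N)^`(n) == 1.
    by have/derivedP[n e] := solN; exists n; apply/eqP.
  exists n => _ _; rewrite -quotient_sub1; last first.
    exact: subset_trans (der_sub _ _) (normal_norm nN).
  by rewrite quotient_der ?normal_norm ?e.
apply/derivedP; exists (\max_(N : {group gT}) sval (exn N))%N.
rewrite -quotient_der ?normal_norm //; apply: quotientS1.
apply/bigcapsP=> N /andP[nN sN].
by apply: subset_trans (svalP (exn N) nN sN); apply: der_sub_le; apply: leq_bigmax.
Qed.

Definition perfect L : Prop := Osolv L = L :> {set gT}.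

Definition adm_orbit L H K : Prop :=
  forall g : gT, L :^ g \subset H -> L :^ g \subset K.

(* The orbit of x is isomorphic to H/K for K the stabilizer of x.              *)
Definition admissible L H (X : hset H) : Prop :=
  forall x : X, adm_orbit L H (stab x).
End Groups.

(* Main.v *)
Require Import Defs.
From mathcomp Require Import all_boot all_order all_algebra all_fingroup.
From mathcomp Require Import all_solvable ring boolp.

Set Implicit Arguments.
Unset Strict Implicit.
Unset Printing Implicit Defensive.

Import GRing.Theory GroupScope.

(** Marks turn the statement into a count of fixed points. For Q <= G and a
    Q-fixed point z of a finite G-set Z there is a mark A(Z) -> int, which counts
    the Q-fixed points in the fibre over z of a G-set over Z. All marks
    together are injective (mark_inj, from Burnside's theorem burnside_marks),
    they are multiplicative, the mark of a transfer is a sum over the points of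
    the fibre (mark_tr), and they are compatible with restriction. Write e_Z for
    the restriction of e to A(Z). Its marks are 1 at the Q whose solvable
    residual is conjugate to L, and 0 at the others.

    The crucial computation is the mark of the norm of e_Y along n : Y -> Z. It is
    1 if Q meets the stabilizer of every y over z in a group with solvable
    residual conjugate to L, and 0 otherwise (mark_nm_eres). As e is only a virtual
    G-set, norms of differences are needed. By base change and multiplicativity
    it is enough to consider a projection G/P -> G/Q and the mark at Q. There the
    norm is additive for this mark (orb_mark_nmD): in the distributive law the
    mixed terms are transfers indexed by sections that Q does not fix. So the
    mark at Q of the norm from P to Q is a homomorphism, which agrees with the mark
    at P on P-sets, and therefore on all of A(G/P) (orb_mark_nm).

    If n is admissible, a group Q fixing z with residual conjugate to L has its
    residual in every stabilizer over z. Comparing marks gives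
    e_Z N(e_Y) = e_Z (eres_nm). With Frobenius reciprocity this shows that
    e_W b(x), for an admissible bispan b from X to W, only depends on e_X x
    (eres_brun). Since e is idempotent, A(X)[1/e] is the quotient of A(X) by the
    relation e_X x = e_X y. So the operations of A descend to it, and all axioms
    are inherited. This also gives the universal property: a map that inverts the
    idempotent e sends it to 1, and so factors through the quotient, uniquely.

    Conversely, if the localization has norms along H/K, the image of the norm of
    e_K is 1. At a conjugate of L contained in H but not in K, the mark
    of this norm is 0 and that of e_H is 1, a contradiction (loc_structure_adm). *)

(** * Finite sets with a group action *)

Lemma inj_surj_bij (S T : Type) (f : S -> T) :
  injective f -> (forall y, exists x, f x = y) -> bijective f.
Proof.
move=> fI fS; exists (fun y => sval (cid (fS y))) => [x|y]; last by case: cid.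
by apply: fI; case: cid.
Qed.

Section HSetTheory.
Variables (gT : finGroupType) (H : {group gT}).
Implicit Types (X Y Z : hset H) (K Q : {group gT}).

Lemma hmap_ext X Y (f g : hmap X Y) : f =1 g -> f = g.
Proof.
case: f g => f fP [g gP] /= /funext e; move: fP gP; rewrite e => fP gP.
by congr HMap; apply: Prop_irrelevance.
Qed.

Lemma hcompE X Y Z (g : hmap Y Z) (f : hmap X Y) x : hcomp g f x = g (f x).
Proof. by []. Qed.

Lemma hs_actK X (x : X) h : h \in H -> hs_act X (hs_act X x h) h^-1 = x.
Proof. by move=> Hh; rewrite -hs_actM ?groupV // mulgV hs_act1. Qed.

Lemma hs_actKV X (x : X) h : h \in H -> hs_act X (hs_act X x h^-1) h = x.
Proof. by move=> Hh; rewrite -hs_actM ?groupV // mulVg hs_act1. Qed.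

Lemma hiso_refl X : hiso X X.
Proof. by exists (hid X); exists id. Qed.

Lemma hiso_trans X Y Z : hiso X Y -> hiso Y Z -> hiso X Z.
Proof. by case=> f bf [g bg]; exists (hcomp g f); apply: bij_comp. Qed.

Lemma hmap_inv X Y (f : hmap X Y) : bijective f ->
  exists g : hmap Y X, cancel f g /\ cancel g f.
Proof.
case=> g fK gK.
have eg y h : h \in H -> g (hs_act Y y h) = hs_act X (g y) h.
  by move=> Hh; rewrite -{1}[y]gK -hm_equiv // fK.
by exists (HMap eg).
Qed.

Section SumMap.
Variables (X1 X2 Y1 Y2 : hset H) (f1 : hmap X1 Y1) (f2 : hmap X2 Y2).
Definition sum_map_fun (u : sum_hset X1 X2) : sum_hset Y1 Y2 :=
  match u with inl x => inl (f1 x) | inr x => inr (f2 x) end.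
Lemma sum_map_equiv u h : h \in H ->
  sum_map_fun (hs_act (sum_hset X1 X2) u h) =
  hs_act (sum_hset Y1 Y2) (sum_map_fun u) h.
Proof. by move=> Hh; case: u => x; rewrite !mk_hsetE //= hm_equiv. Qed.
Definition sum_map : hmap (sum_hset X1 X2) (sum_hset Y1 Y2) := HMap sum_map_equiv.
End SumMap.

Section CoPair.
Variables (X1 X2 Y : hset H) (f1 : hmap X1 Y) (f2 : hmap X2 Y).
Definition copair_fun (u : sum_hset X1 X2) : Y :=
  match u with inl x => f1 x | inr x => f2 x end.
Lemma copair_equiv u h : h \in H ->
  copair_fun (hs_act (sum_hset X1 X2) u h) = hs_act Y (copair_fun u) h.
Proof. by move=> Hh; case: u => x; rewrite mk_hsetE //= hm_equiv. Qed.
Definition copair : hmap (sum_hset X1 X2) Y := HMap copair_equiv.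
End CoPair.

Lemma hiso_sum X1 X2 Y1 Y2 :
  hiso X1 Y1 -> hiso X2 Y2 -> hiso (sum_hset X1 X2) (sum_hset Y1 Y2).
Proof.
case=> f [f' fK f'K] [g [g' gK g'K]]; exists (sum_map f g).
exists (fun u => match u with inl x => inl (f' x) | inr x => inr (g' x) end).
  by case=> x /=; rewrite ?fK ?gK.
by case=> x /=; rewrite ?f'K ?g'K.
Qed.

Section FromVoid.
Variable Y : hset H.
Definition from_void_fun (u : triv_hset H void) : Y := match u with end.
Lemma from_void_equiv u h : h \in H ->
  from_void_fun (hs_act (triv_hset H void) u h) = hs_act Y (from_void_fun u) h.
Proof. by case: u. Qed.
Definition from_void : hmap (triv_hset H void) Y := HMap from_void_equiv.
End FromVoid.

Lemma hiso_void X : #|X| = 0 -> hiso (triv_hset H void) X.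
Proof.
move=> X0; exists (from_void X); apply: inj_surj_bij => [[]|y].
by have := fintype0 y X0.
Qed.

Section PointMap.
Variables (K : {group gT}) (X : hset H) (x : X).
Hypothesis sKx : K \subset stab x.

(** H/K corepresents the K-fixed points: this is the map that sends the coset K
    to x. *)
Definition pt_map_fun (A : quo H K) : X := hs_act X x (fingroup.repr (val A)).

Lemma pt_map_funE h (Hh : h \in H) : pt_map_fun (coset_pt K Hh) = hs_act X x h.
Proof.
rewrite /pt_map_fun /=; case: repr_rcosetP => k Kk.
have /stabP[Hk e] := subsetP sKx k Kk.
by rewrite hs_actM // e.
Qed.

Lemma pt_map_equiv A h : h \in H ->
  pt_map_fun (hs_act (quo H K) A h) = hs_act X (pt_map_fun A) h.
Proof.
have [b [Hb ->]] := coset_ptP A => Hh.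
by rewrite coset_pt_act !pt_map_funE // hs_actM.
Qed.

Definition pt_map : hmap (quo H K) X := HMap pt_map_equiv.
End PointMap.

Definition base K : quo H K := coset_pt K (group1 H).

Lemma coset_pt_base K h (Hh : h \in H) : coset_pt K Hh = hs_act (quo H K) (base K) h.
Proof. by rewrite coset_pt_act; apply: val_inj; rewrite /= mul1g. Qed.

Lemma quo_trans K (A : quo H K) : exists2 h, h \in H & A = hs_act (quo H K) (base K) h.
Proof. by have [h [Hh ->]] := coset_ptP A; exists h => //; exact: coset_pt_base. Qed.

Lemma stab_base K : K \subset H -> stab (base K) = K.
Proof. exact: stab_coset. Qed.

Lemma pt_map_base K X (x : X) (sKx : K \subset stab x) : pt_map sKx (base K) = x.
Proof. by rewrite [LHS]pt_map_funE // hs_act1. Qed.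

Lemma quo_map_ext K X (f g : hmap (quo H K) X) : f (base K) = g (base K) -> f = g.
Proof.
move=> e; apply: hmap_ext => A; have [h Hh ->] := quo_trans A.
by rewrite !hm_equiv // e.
Qed.

Lemma stab_mapH X Y (f : hmap X Y) x : stab x \subset stab (f x).
Proof.
by apply/subsetP=> h /stabP[Hh e]; apply/stabP; rewrite -hm_equiv ?e.
Qed.

Lemma stab_inj X Y (f : hmap X Y) x : injective f -> stab (f x) = stab x.
Proof.
move=> fI; apply/group_inj/eqP; rewrite eqEsubset stab_mapH andbT.
by apply/subsetP=> h /stabP[Hh]; rewrite -hm_equiv // => /fI e; apply/stabP.
Qed.

Lemma stab_act X (x : X) h : h \in H -> stab (hs_act X x h) = (stab x :^ h)%G.
Proof.
move=> Hh; apply/group_inj/setP=> k; rewrite mem_conjg.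
have HkE : (k ^ h^-1 \in H) = (k \in H) by rewrite groupJr ?groupV.
apply/stabP/stabP => -[Hk e]; split; rewrite ?HkE // -?HkE //.
  by rewrite conjgE invgK !hs_actM ?groupM ?groupV // e hs_actK.
rewrite HkE in Hk; rewrite -{2}e -!hs_actM ?HkE //.
by rewrite conjgE invgK -!mulgA mulVg mulg1.
Qed.

Lemma stab_conj_hset X (x : X) g : @stab _ _ (conj_hset g X) x = (stab x :^ g)%G.
Proof.
apply/group_inj/setP=> k; rewrite mem_conjg.
apply/stabP/stabP => -[Hk e].
  by split; [rewrite -mem_conjg | rewrite -[RHS]e mk_hsetE].
have Hk' : k \in (H :^ g)%G by rewrite mem_conjg.
by split=> //; rewrite mk_hsetE.
Qed.

Lemma pt_map_inj X (x : X) : injective (pt_map (subxx (stab x))).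
Proof.
move=> A B; have [a [Ha ->]] := coset_ptP A; have [b [Hb ->]] := coset_ptP B.
rewrite /= !pt_map_funE // => e; apply: val_inj => /=; apply/rcoset_eqP.
rewrite mem_rcoset; apply/stabP; split; first by rewrite groupM ?groupV.
by rewrite hs_actM ?groupV // e hs_actK.
Qed.

Section Split.
Variables (X : hset H) (x : X).
Let off (y : X) := y \notin orbit (hs_act X) H x.
Lemma off_stable y h : h \in H -> off y -> off (hs_act X y h).
Proof.
move=> Hh; apply: contra => /orbitP[k Hk e]; apply/orbitP; exists (k * h^-1).
  by rewrite groupM ?groupV.
by rewrite /= hs_actM ?groupV // [hs_act X x k]e hs_actK.
Qed.
Definition off_orbit : hset H := sub_hset off_stable.
Lemma off_val_equiv (u : off_orbit) h : h \in H ->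
  val (hs_act off_orbit u h) = hs_act X (val u) h.
Proof. exact: val_sub_act. Qed.

Lemma orbit_split : hiso (sum_hset (quo H (stab x)) off_orbit) X.
Proof.
exists (copair (pt_map (subxx (stab x))) (HMap off_val_equiv)).
have orb A : pt_map (subxx (stab x)) A \in orbit (hs_act X) H x.
  have [a [Ha ->]] := coset_ptP A; rewrite /= pt_map_funE //.
  by apply/orbitP; exists a.
apply: inj_surj_bij => [[A|u] [B|v] /= e|y].
- by rewrite (pt_map_inj e).
- by case/negP: (valP v); rewrite -[X in X \in _]/(sval v) -e orb.
- by case/negP: (valP u); rewrite -[X in X \in _]/(sval u) e orb.
- by rewrite (val_inj e).
have [/orbitP[a Ha <-]|offy] := boolP (y \in orbit (hs_act X) H x).
  by exists (inl (coset_pt _ Ha)); rewrite /= pt_map_funE.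
by exists (inr (exist _ y offy)).
Qed.

Lemma card_off_orbit : #|off_orbit| < #|X|.
Proof.
rewrite card_sig; apply: proper_card; apply/properP; split.
  exact: subset_predT.
by exists x; rewrite // inE negbK orbit_refl.
Qed.
End Split.

(** Induction on orbits: the orbit of a point can be split off, and what is left
    is smaller. For H the whole group it reduces a statement about the
    values of a Tambara functor at all finite G-sets to orbits. *)
Lemma hset_ind (P : hset H -> Prop) :
  (forall X Y, hiso X Y -> P X -> P Y) ->
  P (triv_hset H void) ->
  (forall X Y, P X -> P Y -> P (sum_hset X Y)) ->
  (forall K, K \subset H -> P (quo H K)) ->
  forall X, P X.
Proof.
move=> Piso P0 PD Pq X; have [n] := ubnP #|X|; elim: n X => // n IH X Xn.
have [X0|] := posnP #|X|; first exact: Piso (hiso_void X0) P0.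
case/card_gt0P=> x _; apply: Piso (orbit_split x) _; apply: PD.
  exact/Pq/subsetIl.
by apply: IH; apply: leq_trans (card_off_orbit x) _.
Qed.

Definition fixn X Q := #|'Fix_(hs_act X)(Q)|.

Lemma fixedP X Q (x : X) : Q \subset H ->
  (x \in 'Fix_(hs_act X)(Q)) = (Q \subset stab x).
Proof.
move=> sQH; apply/afixP/subsetP => [fx h Qh|sQ h Qh].
  by apply/stabP; rewrite (subsetP sQH) ?fx.
by have /stabP[] := sQ h Qh.
Qed.

Lemma fixnE X Q : Q \subset H -> fixn X Q = #|[set x : X | Q \subset stab x]|.
Proof. by move=> sQH; apply: eq_card => x; rewrite !inE -fixedP // !inE. Qed.

Lemma fixn_iso X Y Q : Q \subset H -> hiso X Y -> fixn X Q = fixn Y Q.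
Proof.
move=> sQH [f bf]; rewrite !fixnE //.
have fI := bij_inj bf; rewrite -(card_imset _ fI); apply: eq_card => y.
have [g fK gK] := bf; rewrite inE -{2}[y]gK stab_inj //.
apply/imsetP/idP => [[x + ->]|sQ]; first by rewrite fK inE.
by exists (g y); rewrite ?inE ?gK.
Qed.

Lemma fixn_sum X Y Q : Q \subset H -> fixn (sum_hset X Y) Q = fixn X Q + fixn Y Q.
Proof.
move=> sQH; rewrite !fixnE // -!sum1_card big_mkcond /= big_sumType /= -!big_mkcond /=.
have inlI : injective (hinl X Y) by move=> ? ? [].
have inrI : injective (hinr X Y) by move=> ? ? [].
congr addn; apply: eq_bigl => x; rewrite [LHS]inE [RHS]inE.
  by have /(congr1 (@gval _)) /= -> := stab_inj x inlI.
by have /(congr1 (@gval _)) /= -> := stab_inj x inrI.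
Qed.

Lemma fixn_prod X Y Q : Q \subset H -> fixn (prod_hset X Y) Q = (fixn X Q * fixn Y Q)%N.
Proof.
move=> sQH; rewrite !fixnE // -cardsX; apply: eq_card => -[x y].
rewrite in_setX !in_set; apply/subsetP/andP => [s|[/subsetP s1 /subsetP s2] h Qh].
  by split; apply/subsetP=> h Qh; have /stabP[Hh] := s h Qh;
     rewrite prod_actE // => -[e1 e2]; apply/stabP.
have /stabP[Hh e1] := s1 h Qh; have /stabP[_ e2] := s2 h Qh.
apply/stabP; rewrite prod_actE //; split=> //; exact: f_equal2 e1 e2.
Qed.

Lemma fixn_void Q : fixn (triv_hset H void) Q = 0.
Proof. by apply: eq_card0 => -[]. Qed.

(** Burnside: remove an orbit with the largest stabilizer from both sides. A
    point fixed by a subgroup Q that is maximal with a fixed point has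
    stabilizer exactly Q. *)
Lemma burnside_marks X Y :
  (forall Q, Q \subset H -> fixn X Q = fixn Y Q) -> hiso X Y.
Proof.
have [n] := ubnP #|X|; elim: n X Y => // n IH X Y Xn e.
have card1 Z : fixn Z 1%G = #|Z|.
  by rewrite fixnE ?sub1G //; apply: eq_card => z; rewrite !inE sub1G.
have [X0|] := posnP #|X|.
  apply: hiso_trans (hiso_sym (hiso_void X0)) (hiso_void _).
  by rewrite -card1 -e ?sub1G // card1.
case/card_gt0P=> x0 _.
pose ok (Q : {group gT}) := (Q \subset H) && (0 < fixn X Q).
have ok1 : ok (stab x0).
  rewrite /ok subsetIl fixnE ?subsetIl //; apply/card_gt0P; exists x0.
  by rewrite inE.
have [Q /andP[sQH fQ] Qmax] := @arg_maxnP _ (stab x0) ok (fun Q => #|Q|) ok1.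
have stabQ Z : (forall R : {group gT}, R \subset H -> fixn Z R = fixn X R) ->
    exists z : Z, stab z = Q.
  move=> eZ; have := fQ; rewrite -eZ // fixnE // => /card_gt0P[z]; rewrite inE => sQ.
  exists z; apply/group_inj/esym/eqP; rewrite eqEcard sQ; apply: Qmax.
  rewrite /ok subsetIl -eZ ?subsetIl // fixnE ?subsetIl //.
  by apply/card_gt0P; exists z; rewrite inE.
have [x xQ] := stabQ X (fun _ _ => erefl).
have [y yQ] := stabQ Y (fun R sRH => esym (e R sRH)).
have ix := orbit_split x; have iy := orbit_split y.
have offi : hiso (off_orbit x) (off_orbit y).
  apply: IH => [|R sRH].
    by apply: leq_trans (card_off_orbit x) _.
  apply: (@addnI (fixn (quo H Q) R)); rewrite -!fixn_sum // -{1}xQ -{1}yQ.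
  by rewrite (fixn_iso sRH ix) (fixn_iso sRH iy) e.
apply: hiso_trans (hiso_sym ix) _; apply: hiso_trans _ iy.
by apply: hiso_sum offi; rewrite xQ yQ; apply: hiso_refl.
Qed.
End HSetTheory.

(** * The calculus of bispans *)

Section Pullbacks.
Variables (gT : finGroupType) (H : {group gT}).

Definition is_pullback (P X Y Z : hset H) (f : hmap P X) (g : hmap P Y)
    (u : hmap X Z) (v : hmap Y Z) : Prop :=
  [/\ forall p, u (f p) = v (g p),
      forall p p', f p = f p' -> g p = g p' -> p = p' &
      forall x y, u x = v y -> exists p, f p = x /\ g p = y].

Section Canonical.
Variables (X Y Z : hset H) (u : hmap X Z) (v : hmap Y Z).
Definition agree (w : prod_hset X Y) := u w.1 == v w.2.
Lemma agree_stable w h : h \in H -> agree w -> agree (hs_act (prod_hset X Y) w h).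
Proof. by move=> Hh; rewrite /agree prod_actE //= !hm_equiv // => /eqP->. Qed.
Definition pull : hset H := sub_hset agree_stable.
Lemma pull1_equiv (w : pull) h : h \in H ->
  (val (hs_act pull w h)).1 = hs_act X (val w).1 h.
Proof. by move=> Hh; rewrite val_sub_act // prod_actE. Qed.
Lemma pull2_equiv (w : pull) h : h \in H ->
  (val (hs_act pull w h)).2 = hs_act Y (val w).2 h.
Proof. by move=> Hh; rewrite val_sub_act // prod_actE. Qed.
Definition pull1 : hmap pull X := HMap pull1_equiv.
Definition pull2 : hmap pull Y := HMap pull2_equiv.
Lemma pullP : is_pullback pull1 pull2 u v.
Proof.
split=> [p|p p' /= e1 e2|x y e]; first exact/eqP/(valP p).
  by apply: val_inj; case: p p' e1 e2 => [[? ?] ?] [[? ?] ?] /= -> ->.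
by have /eqP e' := e; exists (exist (fun w => agree w) (x, y) e').
Qed.
End Canonical.

Lemma pullback_idl (X Y : hset H) (f : hmap X Y) : is_pullback f (hid X) (hid Y) f.
Proof. by split=> // x y /= ->; exists y. Qed.

Lemma pullback_idr (X Y : hset H) (f : hmap X Y) : is_pullback (hid X) f f (hid Y).
Proof. by split=> // x y /= <-; exists x. Qed.

Lemma pullback_sym (P X Y Z : hset H) (f : hmap P X) (g : hmap P Y)
    (u : hmap X Z) (v : hmap Y Z) : is_pullback f g u v -> is_pullback g f v u.
Proof.
case=> c i s; split=> [p|p p' e1 e2|y x e]; [by rewrite c | exact: i |].
by have [p [e1 e2]] := s x y (esym e); exists p.
Qed.

Lemma pullback_inl (X X' Y Y' : hset H) (f : hmap X Y) (f' : hmap X' Y') :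
  is_pullback (hinl X X') f (sum_map f f') (hinl Y Y').
Proof.
split=> [//|p p' [] //|[x|x] y] /=; last by [].
by case=> <-; exists x.
Qed.

Lemma pullback_inr (X X' Y Y' : hset H) (f : hmap X Y) (f' : hmap X' Y') :
  is_pullback (hinr X X') f' (sum_map f f') (hinr Y Y').
Proof.
split=> [//|p p' [] //|[x|x] y] /=; first by [].
by case=> <-; exists x.
Qed.

Lemma pullback_fold (X Y : hset H) (f : hmap X Y) :
  is_pullback (hfold X) (sum_map f f) f (hfold Y).
Proof.
split=> [[x|x] //|[x|x] [y|y] /= -> //|x [y|y] /= e].
  by exists (inl x); rewrite /= e.
by exists (inr x); rewrite /= e.
Qed.
End Pullbacks.

Section Composition.
Variable gT : finGroupType.
Implicit Types X Y Z W : gset gT.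

(** When the second bispan involves no norm, a section over a point is a single
    value, so that the set of sections is a pullback. The pullbacks are left
    abstract: in each use they have a simpler form than the canonical one. *)
Section Left.
Variables (X Y Z C : gset gT) (b1 : bispan X Y) (r2 : hmap C Y) (t2 : hmap C Z).
Let b2 := Bispan r2 (hid C) t2.
Variables (Y' Z' : gset gT) (p : hmap Z' C) (q : hmap Z' (bs_Z b1)).
Variables (a : hmap Y' (bs_Y b1)) (n : hmap Y' Z').
Hypotheses (pb1 : is_pullback p q r2 (bs_t b1)) (pb2 : is_pullback a n (bs_n b1) q).

Let sec (z : Z') : {ffun C -> option (bs_Z b1)} :=
  [ffun c => if c == p z then Some (q z) else None].
Let sec_is_sec z : is_sec (b2 := b2) (p z, sec z).
Proof.
apply/forallP=> c; rewrite /= ffunE; case: eqP => [->|/eqP] //=.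
by case: pb1 => ->.
Qed.
Let vfun z : comp_Z b2 b1 := exist (fun u => is_sec u) _ (sec_is_sec z).
Let v_equiv z h : h \in [set: gT]%G -> vfun (hs_act Z' z h) = hs_act _ (vfun z) h.
Proof.
move=> hT; apply: val_inj; rewrite val_comp_Z_act psec_actE.
congr (_, _); first exact: hm_equiv.
apply/ffunP=> c; rewrite !ffunE.
have -> : (c == p (hs_act Z' z h)) = (hs_act C c h^-1 == p z).
  rewrite hm_equiv //; apply/eqP/eqP => [->|<-]; first by rewrite hs_actK.
  by rewrite hs_actKV.
by case: ifP => // _; rewrite /= hm_equiv.
Qed.
Let v := HMap v_equiv.
Let eval_ok (y : Y') : is_eval (b2 := b2) (a y, p (n y), v (n y)).
Proof. by rewrite /is_eval /= ffunE eqxx; case: pb2 => ->. Qed.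
Let ufun y : comp_Y b2 b1 := exist (fun u => is_eval u) _ (eval_ok y).
Let u_equiv y h : h \in [set: gT]%G -> ufun (hs_act Y' y h) = hs_act _ (ufun y) h.
Proof.
move=> hT; apply: val_inj; rewrite val_comp_Y_act.
by rewrite -!hm_equiv //= !hm_equiv.
Qed.

Lemma bs_comp_left :
  bispan_iso (Bispan (hcomp (bs_r b1) a) n (hcomp t2 p)) (bs_comp b2 b1).
Proof.
have [c1 i1 s1] := pb1; have [c2 i2 s2] := pb2.
have vI : injective v.
  move=> z z' /(congr1 val) [ep /ffunP/(_ (p z))]; rewrite !ffunE -ep eqxx => -[eq].
  exact: i1.
exists (HMap u_equiv), v; split=> //.
- apply: inj_surj_bij => [y y' /(congr1 val) e|[[[a' c'] u] ev]].
    have [ea en] := (congr1 (fun w => w.1.1) e, congr1 (fun w => w.2) e).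
    exact: i2 ea (vI _ _ en).
  have /forallP/(_ c') := valP u; move/eqP: (ev) => /= ->.
  case/andP=> /eqP e1 /eqP e2.
  have [z [ez1 ez2]] := s1 _ _ (esym e2).
  have [y [ey1 ey2]] := s2 _ _ (esym ez2).
  exists y; apply: val_inj => /=; rewrite ey1 ey2 ez1; congr (_, _).
  apply: val_inj => /=; case: u ev e1 => -[c'' s] us /= ev e1.
  subst c''.
  have es : s c' = Some (bs_n b1 a') by apply/eqP.
  rewrite ez1; congr (_, _); apply/ffunP=> c0; rewrite ffunE ez1.
  have /forallP/(_ c0) := us; rewrite /=.
  case: eqP => [->|nc0]; first by rewrite es ez2.
  by case: (s c0) => // b /andP[/eqP e3]; case: nc0.
apply: inj_surj_bij => // -[[c s] us].
have := forallP us c; rewrite /= eqxx /=; case es: (s c) => [b|] //= /eqP e.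
have [z [ez1 ez2]] := s1 _ _ (esym e).
exists z; apply: val_inj => /=; rewrite ez1; congr (_, _); apply/ffunP=> c0.
rewrite ffunE ez1; have := forallP us c0; rewrite /=.
case: eqP => [->|nc0]; first by rewrite es ez2.
by case: (s c0) => // b' /andP[/eqP e3].
Qed.
End Left.

(** When the first bispan involves no transfer, there is exactly one section
    over each point. *)
Section Right.
Variables (X Y Z A : gset gT) (b2 : bispan Y Z) (r1 : hmap A X) (n1 : hmap A Y).
Let b1 := Bispan r1 n1 (hid Y).
Variables (Y' : gset gT) (a : hmap Y' A) (c : hmap Y' (bs_Y b2)).
Hypothesis pb : is_pullback a c n1 (bs_r b2).

Let sec (z : bs_Z b2) : {ffun bs_Y b2 -> option Y} :=
  [ffun c => if bs_n b2 c == z then Some (bs_r b2 c) else None].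
Let sec_is_sec z : is_sec (b1 := b1) (z, sec z).
Proof.
by apply/forallP=> c'; rewrite /= ffunE; case: ifP => //= ->.
Qed.
Let vfun z : comp_Z b2 b1 := exist (fun u => is_sec u) _ (sec_is_sec z).
Let v_equiv z h : h \in [set: gT]%G ->
  vfun (hs_act _ z h) = hs_act _ (vfun z) h.
Proof.
move=> hT; apply: val_inj; rewrite val_comp_Z_act psec_actE.
congr (_, _); apply/ffunP=> c'; rewrite !ffunE.
have -> : (bs_n b2 c' == hs_act _ z h) = (bs_n b2 (hs_act _ c' h^-1) == z).
  rewrite hm_equiv ?inE //; apply/eqP/eqP => [->|<-]; first by rewrite hs_actK.
  by rewrite hs_actKV.
by case: ifP => // _; rewrite /= -hm_equiv // hs_actKV.
Qed.
Let v := HMap v_equiv.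
Let eval_ok (y : Y') : is_eval (b1 := b1) (a y, c y, v (bs_n b2 (c y))).
Proof. by rewrite /is_eval /= ffunE eqxx; case: pb => ->. Qed.
Let ufun y : comp_Y b2 b1 := exist (fun u => is_eval u) _ (eval_ok y).
Let u_equiv y h : h \in [set: gT]%G -> ufun (hs_act Y' y h) = hs_act _ (ufun y) h.
Proof.
move=> hT; apply: val_inj; rewrite val_comp_Y_act.
by rewrite -!hm_equiv //= !hm_equiv.
Qed.

Lemma bs_comp_right :
  bispan_iso (Bispan (hcomp r1 a) (hcomp (bs_n b2) c) (bs_t b2)) (bs_comp b2 b1).
Proof.
have [c1 i1 s1] := pb.
have secE (u : comp_Z b2 b1) : u = v (val u).1.
  case: u => -[d s] us; apply: val_inj => /=; congr (_, _); apply/ffunP=> c0.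
  rewrite ffunE; have := forallP us c0; rewrite /=.
  by case: (s c0) => [b /andP[-> /eqP <-] //|]; case: eqP.
exists (HMap u_equiv), v; split=> //.
- apply: inj_surj_bij => [y y' /(congr1 val) e|[[[a' c'] u] ev]].
    have [ea en] := (congr1 (fun w => w.1.1) e, congr1 (fun w => w.1.2) e).
    exact: i1 ea en.
  have /forallP/(_ c') := valP u; move/eqP: (ev) => /= ->.
  case/andP=> /eqP e1 /eqP e2.
  have [y [ey1 ey2]] := s1 _ _ e2.
  exists y; apply: val_inj => /=; rewrite ey1 ey2; congr (_, _).
  by rewrite [u]secE -[vfun]/(v : _ -> _) e1.
by apply: inj_surj_bij => [z z' /(congr1 val) []//|u]; exists (val u).1; rewrite -secE.
Qed.
End Right.
End Composition.

(** * Consequences of the Tambara axioms *)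

Section TambaraTheory.
Variables (gT : finGroupType) (A : tambara (full_indexing gT)).
Implicit Types X Y Z W : gset gT.
Local Open Scope ring_scope.

(** Every map of finite G-sets lies in the category of norm maps, so a bispan
    needs no proof that its middle map is allowed. *)
Definition brun X Y (b : bispan X Y) : A X -> A Y :=
  tb_map (@IBispan gT (full_indexing gT) X Y b (fun=> I)).
Definition rs X Y (f : hmap X Y) : A Y -> A X := brun (bs_R f).
Definition nm X Y (f : hmap X Y) : A X -> A Y := brun (bs_N f).
Definition tr X Y (f : hmap X Y) : A X -> A Y := brun (bs_T f).

Lemma tb_mapE X Y (b : ibispan (full_indexing gT) X Y) (x : A X) : tb_map b x = brun b x.
Proof.
case: b => b inb; rewrite /brun /=; congr (tb_map _ _); congr IBispan.
exact: Prop_irrelevance.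
Qed.

Lemma brun_iso X Y (b b' : bispan X Y) : bispan_iso b b' -> brun b =1 brun b'.
Proof. by move=> e x; apply: tb_iso. Qed.

Lemma brun_comp X Y Z (b2 : bispan Y Z) (b1 : bispan X Y) x :
  brun (bs_comp b2 b1) x = brun b2 (brun b1 x).
Proof. by rewrite -[RHS](tb_comp (t := A)) tb_mapE. Qed.

Lemma rs_id X x : rs (hid X) x = x.
Proof. by rewrite -[RHS](tb_id (t := A)) tb_mapE. Qed.
Lemma nm_id X x : nm (hid X) x = x.
Proof. exact: rs_id. Qed.
Lemma tr_id X x : tr (hid X) x = x.
Proof. exact: rs_id. Qed.

Lemma brun_ext X Y B C (r r' : hmap B X) (n n' : hmap B C) (t t' : hmap C Y) :
  r =1 r' -> n =1 n' -> t =1 t' -> brun (Bispan r n t) =1 brun (Bispan r' n' t').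
Proof. by move=> /hmap_ext-> /hmap_ext-> /hmap_ext->. Qed.

Lemma rs_comp X Y Z (g : hmap Y Z) (f : hmap X Y) x : rs f (rs g x) = rs (hcomp g f) x.
Proof.
rewrite -[LHS]brun_comp.
rewrite -(brun_iso (bs_comp_right (b2 := bs_R f) g (pullback_idl f))).
exact: brun_ext.
Qed.

Lemma nm_comp X Y Z (g : hmap Y Z) (f : hmap X Y) x : nm g (nm f x) = nm (hcomp g f) x.
Proof.
rewrite -[LHS]brun_comp.
rewrite -(brun_iso (bs_comp_right (b2 := bs_N g) (hid X) (pullback_idr f))).
exact: brun_ext.
Qed.

Lemma tr_comp X Y Z (g : hmap Y Z) (f : hmap X Y) x : tr g (tr f x) = tr (hcomp g f) x.
Proof.
rewrite -[LHS]brun_comp.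
rewrite -(brun_iso (bs_comp_left g (b1 := bs_T f) (pullback_idl f)
  (pullback_idl (hid X)))).
exact: brun_ext.
Qed.

Lemma brunE X Y (b : bispan X Y) x : brun b x = tr (bs_t b) (nm (bs_n b) (rs (bs_r b) x)).
Proof.
case: b => B C r n t /=.
have -> : nm n (rs r x) = brun (Bispan r n (hid C)) x.
  rewrite -[LHS]brun_comp.
  rewrite -(brun_iso (bs_comp_right (b2 := bs_N n) r (pullback_idl (hid B)))).
  exact: brun_ext.
rewrite -[RHS]brun_comp.
rewrite -(brun_iso (bs_comp_left t (b1 := Bispan r n (hid C)) (pullback_idl (hid C))
  (pullback_idr n))).
exact: brun_ext.
Qed.

Lemma rs_tr P X Y Z (f : hmap P X) (g : hmap P Y) (u : hmap X Z) (v : hmap Y Z) x :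
  is_pullback f g u v -> rs v (tr u x) = tr g (rs f x).
Proof.
move=> pb; rewrite -[LHS]brun_comp.
have e : bispan_iso _ (bs_comp (bs_R v) (bs_T u)) :=
  bs_comp_left (hid Y) (b1 := bs_T u) (pullback_sym pb) (pullback_idl f).
by rewrite -(brun_iso e) brunE /= nm_id; congr (tr _ _); [|congr rs]; apply: hmap_ext.
Qed.

Lemma rs_nm P X Y Z (f : hmap P X) (g : hmap P Y) (u : hmap X Z) (v : hmap Y Z) x :
  is_pullback f g u v -> rs v (nm u x) = nm g (rs f x).
Proof.
move=> pb; rewrite -[LHS]brun_comp.
have e : bispan_iso _ (bs_comp (bs_R v) (bs_N u)) :=
  bs_comp_right (b2 := bs_R v) (hid X) pb.
by rewrite -(brun_iso e) brunE /= tr_id; congr (nm _ _); [|congr rs]; apply: hmap_ext.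
Qed.

(** The distributive law: norms of transfers are transfers over the set of
    sections, by the definition of the composition of bispans. *)
Lemma nm_tr X Y Z (n : hmap Y Z) (t : hmap X Y) x :
  let b := bs_comp (bs_N n) (bs_T t) in
  nm n (tr t x) = tr (bs_t b) (nm (bs_n b) (rs (bs_r b) x)).
Proof. by move=> b; rewrite -[LHS]brun_comp brunE. Qed.

Lemma rs_pair X Y (x : A X) (y : A Y) :
  exists c : A (sum_hset X Y), rs (hinl X Y) c = x /\ rs (hinr X Y) c = y.
Proof.
have [g _ gK] := tb_prod A X Y; exists (g (x, y)).
by have := gK (x, y); rewrite !tb_mapE => -[].
Qed.

Lemma rs_sum_inj X Y (c c' : A (sum_hset X Y)) :
  rs (hinl X Y) c = rs (hinl X Y) c' -> rs (hinr X Y) c = rs (hinr X Y) c' -> c = c'.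
Proof.
by move=> e1 e2; apply: (bij_inj (tb_prod A X Y)); rewrite !tb_mapE; congr (_, _).
Qed.

Lemma tr_fold X (c : A (sum_hset X X)) :
  tr (hfold X) c = rs (hinl X X) c + rs (hinr X X) c.
Proof. by have := tb_add c; rewrite !tb_mapE. Qed.

Lemma nm_fold X (c : A (sum_hset X X)) :
  nm (hfold X) c = rs (hinl X X) c * rs (hinr X X) c.
Proof. by have := tb_mul c; rewrite !tb_mapE. Qed.

Lemma tr_sum X1 X2 Y (f : hmap (sum_hset X1 X2) Y) c :
  tr f c = tr (hcomp f (hinl X1 X2)) (rs (hinl X1 X2) c)
         + tr (hcomp f (hinr X1 X2)) (rs (hinr X1 X2) c).
Proof.
pose g := sum_map (hcomp f (hinl X1 X2)) (hcomp f (hinr X1 X2)).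
have -> : f = hcomp (hfold Y) g by apply: hmap_ext => -[].
by rewrite -tr_comp tr_fold (rs_tr _ (pullback_inl _ _)) (rs_tr _ (pullback_inr _ _));
  congr (_ + _); congr (tr _ _); apply: hmap_ext.
Qed.

Lemma nm_sum X1 X2 Y (f : hmap (sum_hset X1 X2) Y) c :
  nm f c = nm (hcomp f (hinl X1 X2)) (rs (hinl X1 X2) c)
         * nm (hcomp f (hinr X1 X2)) (rs (hinr X1 X2) c).
Proof.
pose g := sum_map (hcomp f (hinl X1 X2)) (hcomp f (hinr X1 X2)).
have -> : f = hcomp (hfold Y) g by apply: hmap_ext => -[].
by rewrite -nm_comp nm_fold (rs_nm _ (pullback_inl _ _)) (rs_nm _ (pullback_inr _ _));
  congr (_ * _); congr (nm _ _); apply: hmap_ext.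
Qed.

Lemma rs_fold_pair X Y (f : hmap X Y) (c : A (sum_hset Y Y)) :
  rs (hinl X X) (rs (sum_map f f) c) = rs f (rs (hinl Y Y) c) /\
  rs (hinr X X) (rs (sum_map f f) c) = rs f (rs (hinr Y Y) c).
Proof. by rewrite !rs_comp; split; congr rs; apply: hmap_ext. Qed.

Lemma rsD X Y (f : hmap X Y) x y : rs f (x + y) = rs f x + rs f y.
Proof.
have [c [<- <-]] := rs_pair x y; rewrite -tr_fold.
rewrite (rs_tr _ (pullback_sym (pullback_fold f))) tr_fold.
by case: (rs_fold_pair f c) => -> ->.
Qed.

Lemma rsM X Y (f : hmap X Y) x y : rs f (x * y) = rs f x * rs f y.
Proof.
have [c [<- <-]] := rs_pair x y; rewrite -nm_fold.
rewrite (rs_nm _ (pullback_sym (pullback_fold f))) nm_fold.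
by case: (rs_fold_pair f c) => -> ->.
Qed.

Lemma trD X Y (f : hmap X Y) x y : tr f (x + y) = tr f x + tr f y.
Proof.
have [c [<- <-]] := rs_pair x y; rewrite -tr_fold tr_comp.
have -> : hcomp f (hfold X) = hcomp (hfold Y) (sum_map f f) by apply: hmap_ext => -[].
by rewrite -tr_comp tr_fold (rs_tr _ (pullback_inl _ _)) (rs_tr _ (pullback_inr _ _)).
Qed.

Lemma nmM X Y (f : hmap X Y) x y : nm f (x * y) = nm f x * nm f y.
Proof.
have [c [<- <-]] := rs_pair x y; rewrite -nm_fold nm_comp.
have -> : hcomp f (hfold X) = hcomp (hfold Y) (sum_map f f) by apply: hmap_ext => -[].
by rewrite -nm_comp nm_fold (rs_nm _ (pullback_inl _ _)) (rs_nm _ (pullback_inr _ _)).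
Qed.

Lemma morph_add0 (U V : zmodType) (f : U -> V) :
  (forall x y, f (x + y) = f x + f y) -> f 0 = 0 /\ forall x y, f (x - y) = f x - f y.
Proof.
move=> fD; have f0 : f 0 = 0 by apply: (@addrI _ (f 0)); rewrite -fD !addr0.
split=> // x y; apply: (@addIr _ (f y)); rewrite -fD !subrK //.
Qed.

Lemma rsB X Y (f : hmap X Y) x y : rs f (x - y) = rs f x - rs f y.
Proof. by case: (morph_add0 (rsD f)). Qed.
Lemma tr0 X Y (f : hmap X Y) : tr f 0 = 0.
Proof. by case: (morph_add0 (trD f)). Qed.
Lemma trB X Y (f : hmap X Y) x y : tr f (x - y) = tr f x - tr f y.
Proof. by case: (morph_add0 (trD f)). Qed.

(** An element x of A(X) is the norm along the fold map of the norm of x along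
    the second inclusion X -> X + X, which restricts to x on the second summand
    and to the norm from the empty set on the first. So the latter is a unit
    for the product. *)
Lemma nm_void X z : nm (from_void X) z = 1.
Proof.
suff unit x : nm (from_void X) z * x = x by rewrite -[LHS]mulr1 unit.
have fI : hcomp (hfold X) (hinr X X) = hid X by exact: hmap_ext.
have pbl : is_pullback (from_void X) (from_void X) (hinr X X) (hinl X X).
  by split=> [[]|[]|].
have pbr : is_pullback (hid X) (hid X) (hinr X X) (hinr X X).
  by split=> // ? ? [->]; eexists.
rewrite -[RHS]nm_id -fI -nm_comp nm_fold (rs_nm _ pbl) (rs_nm _ pbr) rs_id nm_id.
by congr (nm _ _ * _); apply: tb_empty.
Qed.

Let star : A (triv_hset [set: gT]%G void) := 0.

Lemma rs1 X Y (f : hmap X Y) : rs f 1 = 1.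
Proof.
rewrite -(nm_void Y star) -(nm_void X star).
have pb : is_pullback (hid _) (from_void X) (from_void Y) f by split=> [[]|[]|[]].
by rewrite (rs_nm _ pb) rs_id.
Qed.

Lemma nm1 X Y (f : hmap X Y) : nm f 1 = 1.
Proof.
rewrite -(nm_void X star) nm_comp -(nm_void Y star).
by congr nm; apply: hmap_ext => -[].
Qed.

Lemma tr_bij X Y (f : hmap X Y) (g : hmap Y X) x :
  cancel f g -> cancel g f -> tr f x = rs g x.
Proof.
move=> fK gK; have pb : is_pullback g (hid Y) f (hid Y).
  by split=> [y|y y' _ //|x' y /= <-]; [rewrite /= gK | exists (f x'); rewrite fK].
by rewrite -[LHS]rs_id (rs_tr _ pb) tr_id.
Qed.

Lemma nm_bij X Y (f : hmap X Y) (g : hmap Y X) x :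
  cancel f g -> cancel g f -> nm f x = rs g x.
Proof.
move=> fK gK; have pb : is_pullback g (hid Y) f (hid Y).
  by split=> [y|y y' _ //|x' y /= <-]; [rewrite /= gK | exists (f x'); rewrite fK].
by rewrite -[LHS]rs_id (rs_nm _ pb) nm_id.
Qed.

End TambaraTheory.

(** * Marks *)

Section Marks.
Variables (gT : finGroupType) (A : burnside gT).
Implicit Types X Y Z W : gset gT.
Local Open Scope ring_scope.

Lemma cl_void (H : {group gT}) : bt_cl A (triv_hset H void) = 0.
Proof.
apply: (@addrI _ (bt_cl A (triv_hset H void))); rewrite -bt_sum addr0.
apply/bt_eq; exists (triv_hset H void); apply: hiso_sum; last exact: hiso_refl.
by apply/hiso_sym/hiso_void; rewrite card_sum card_void.
Qed.

Lemma cl_sub_marks (H Q : {group gT}) (X Y X' Y' : hset H) : Q \subset H ->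
  bt_cl A X - bt_cl A Y = bt_cl A X' - bt_cl A Y' ->
  (fixn X Q)%:Z - (fixn Y Q)%:Z = (fixn X' Q)%:Z - (fixn Y' Q)%:Z.
Proof.
move=> sQH /eqP; rewrite subr_eq addrAC eq_sym subr_eq -!bt_sum => /eqP.
case/bt_eq=> Z /(fixn_iso sQH); rewrite !fixn_sum // => /addIn e.
apply/eqP; rewrite subr_eq addrAC eq_sym subr_eq -!PoszD eqz_nat.
by rewrite e.
Qed.

(** The mark at Q of the virtual Q-set a: X and Y are a choice, and orb_markB shows
    that any other pair gives the same number. *)
Definition orb_mark (Q : {group gT}) (a : A (orb Q)) : int :=
  let: exist X hX := cid (bt_gen a) in
  let: exist Y _ := cid hX in (fixn X Q)%:Z - (fixn Y Q)%:Z.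

Lemma orb_markB (Q : {group gT}) (X Y : hset Q) :
  orb_mark (bt_cl A X - bt_cl A Y) = (fixn X Q)%:Z - (fixn Y Q)%:Z.
Proof.
rewrite /orb_mark; case: cid => X' hX; case: cid => Y' e.
exact/esym/(cl_sub_marks (subxx Q) e).
Qed.

Lemma orb_mark_cl (Q : {group gT}) (X : hset Q) : orb_mark (bt_cl A X) = (fixn X Q)%:Z.
Proof.
by rewrite -[bt_cl A X]subr0 -(cl_void Q) orb_markB fixn_void subr0.
Qed.

Lemma orb_markD (Q : {group gT}) (a b : A (orb Q)) :
  orb_mark (a + b) = orb_mark a + orb_mark b.
Proof.
have [X [Y ->]] := bt_gen a; have [X' [Y' ->]] := bt_gen b.
by rewrite addrACA -opprD -!bt_sum !orb_markB !fixn_sum // !PoszD opprD addrACA.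
Qed.

Lemma orb_mark0 (Q : {group gT}) : orb_mark (0 : A (orb Q)) = 0.
Proof. by case: (morph_add0 (@orb_markD Q)). Qed.

Lemma orb_markM (Q : {group gT}) (a b : A (orb Q)) :
  orb_mark (a * b) = orb_mark a * orb_mark b.
Proof.
have [X [Y ->]] := bt_gen a; have [X' [Y' ->]] := bt_gen b.
have -> : (bt_cl A X - bt_cl A Y) * (bt_cl A X' - bt_cl A Y') =
    bt_cl A X * bt_cl A X' + bt_cl A Y * bt_cl A Y'
    - (bt_cl A X * bt_cl A Y' + bt_cl A Y * bt_cl A X') by ring.
rewrite -!bt_prod -!bt_sum !orb_markB !fixn_sum // !fixn_prod // !PoszD !PoszM.
by ring.
Qed.

Lemma orb_mark1 (Q : {group gT}) : orb_mark (1 : A (orb Q)) = 1.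
Proof.
have e : orb_mark (bt_cl A (triv_hset Q unit)) = 1.
  rewrite orb_mark_cl fixnE //; congr (Posz _); rewrite -[RHS]card_unit.
  apply: eq_card => x; rewrite !inE; apply/subsetP=> h Qh.
  by apply/stabP; rewrite mk_hsetE.
by rewrite -[LHS]mulr1 -e -orb_markM mul1r.
Qed.

(** If a is the class of a G-set over Z, this is the number of Q-fixed points
    of its fibre over z. The value 0 at the points that Q moves makes the
    formula for transfers unconditional. *)
Definition mark (Q : {group gT}) Z (z : Z) (a : A Z) : int :=
  if pselect (Q \subset stab z) is left s then orb_mark (rs (pt_map s) a) else 0.

Lemma markE (Q : {group gT}) Z (z : Z) (s : Q \subset stab z) (a : A Z) :
  mark Q z a = orb_mark (rs (pt_map s) a).
Proof.
rewrite /mark; case: pselect => [s'|] //.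
by rewrite (bool_irrelevance s s').
Qed.

Lemma mark0 (Q : {group gT}) Z (z : Z) (a : A Z) :
  ~~ (Q \subset stab z) -> mark Q z a = 0.
Proof. by rewrite /mark; case: pselect => // s /negP. Qed.

Lemma mark_rs (Q : {group gT}) W Z (f : hmap W Z) (w : W) (a : A Z) :
  Q \subset stab w -> mark Q w (rs f a) = mark Q (f w) a.
Proof.
move=> s; have s' := subset_trans s (stab_mapH f w).
rewrite (markE s) (markE s') rs_comp; congr (orb_mark (rs _ _)).
by apply: quo_map_ext; rewrite hcompE !pt_map_base.
Qed.

Lemma markM (Q : {group gT}) Z (z : Z) (a b : A Z) :
  mark Q z (a * b) = mark Q z a * mark Q z b.
Proof.
have [s|s] := boolP (Q \subset stab z); last by rewrite !mark0.
by rewrite !(markE s) rsM orb_markM.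
Qed.

Lemma sub_stab_base (Q K : {group gT}) : K \subset Q ->
  K \subset stab (base [set: gT]%G Q).
Proof. by move=> s; rewrite stab_base ?subsetT. Qed.

Lemma orb_proj_base (H K : {group gT}) (s : K \subset H) :
  orb_proj s (base _ K) = base _ H.
Proof. by apply: val_inj; rewrite /= !mulg1 mulGSid. Qed.

Lemma pt_map_orb (K : {group gT}) (d : orb K) :
  exists g : hmap (orb K) (orb (stab d)),
    cancel (pt_map (subxx (stab d))) g /\ cancel g (pt_map (subxx (stab d))).
Proof.
apply: hmap_inv; apply: inj_surj_bij; first exact: pt_map_inj.
move=> y; have [k kT ->] := quo_trans y; have [k0 k0T ed] := quo_trans d.
exists (hs_act _ (base _ _) (k0^-1 * k)%g); rewrite hm_equiv ?inE // pt_map_base.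
by rewrite hs_actM ?inE // {1}ed hs_actK.
Qed.

(* The second components of the points of one class form a coset of P, and a
   class that Q fixes meets all of Q. *)
Lemma ind_nofix (P Q : {group gT}) (X : hset P) :
  ~~ (Q \subset P) -> fixn (ind_hset Q X) Q = 0%N.
Proof.
move=> nsQP; rewrite fixnE //; apply: eq_card0 => u; rewrite !inE; apply: contraNF nsQP.
case: u => S /[dup] /existsP[x /existsP[h /andP[Qh /eqP eS]]] Sin /subsetP fixu.
have memS q : q \in Q -> exists2 k, k \in P & q = (k^-1 * h)%g.
  move=> Qq; have /fixu/stabP[Qa] : (h^-1 * q)%g \in Q by rewrite groupM ?groupV.
  move/(congr1 val); rewrite mk_hsetE // val_ind_op //= eS ind_shift_cls mulKVg => e.
  have : (x, q) \in ind_cls x h.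
    by rewrite -e; apply/imsetP; exists 1%g; rewrite ?hs_act1 ?invg1 ?mul1g.
  by case/imsetP=> k Pk [_ ->]; exists k.
have [k Pk ek] := memS 1%g (group1 Q).
have Ph : h \in P by rewrite -[h](mulKVg k) -ek mulg1.
by apply/subsetP=> q /memS[k' Pk' ->]; rewrite groupM ?groupV.
Qed.

(** A Q-fixed point d over the base point spans an orbit on which t is an
    isomorphism; on any other orbit the transfer is an induction from a proper
    subgroup of Q, and produces no Q-fixed points. *)
Lemma orb_mark_tr (Q : {group gT}) D (t : hmap D (orb Q)) (x : A D) :
  orb_mark (tr t x) = \sum_(d | t d == base _ Q) mark Q d x.
Proof.
move: D t x; apply: hset_ind => [X Y [f bf] IH t x| t x | X Y IX IY t x | K _ t x].
- have [g [fK gK]] := hmap_inv bf.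
  have -> : tr t x = tr (hcomp t f) (rs f x).
    rewrite -tr_comp (tr_bij _ fK gK) rs_comp -[in LHS](rs_id x).
    by congr (tr _ (rs _ _)); apply: hmap_ext => y /=; rewrite gK.
  rewrite IH [RHS](reindex f) /=; last exact: onW_bij.
  apply: eq_bigr => d _; have [s|s] := boolP (Q \subset stab d).
    exact: mark_rs.
  by rewrite !mark0 // stab_inj //; apply: bij_inj.
- have -> : x = 0 by apply: tb_empty.
  rewrite tr0 orb_mark0 big1 // => -[].
- rewrite tr_sum orb_markD IX IY [RHS]big_sumType /=.
  congr (_ + _); apply: eq_bigr => d _; have [s|s] := boolP (Q \subset stab d).
  + by rewrite mark_rs.
  + by rewrite !mark0 // (@stab_inj _ _ _ _ (hinl X Y)) // => ? ? [].
  + by rewrite mark_rs.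
  by rewrite !mark0 // (@stab_inj _ _ _ _ (hinr X Y)) // => ? ? [].
have [k kT ek] := quo_trans (t (base _ K)).
pose d := hs_act (orb K) (base _ K) k^-1%g.
have td : t d = base _ Q by rewrite hm_equiv ?inE // ek hs_actK.
have sdQ : stab d \subset Q.
  by have := stab_mapH t d; rewrite td stab_base // subsetT.
have [g [fK gK]] := pt_map_orb d; set f := pt_map _ in fK gK.
have fd : f (base _ _) = d by rewrite /f pt_map_base.
clearbody f.
have -> : tr t x = tr (orb_proj sdQ) (rs f x).
  have -> : tr t x = tr (hcomp t f) (rs f x).
    rewrite -tr_comp (tr_bij _ fK gK) rs_comp -[in LHS](rs_id x).
    by congr (tr _ (rs _ _)); apply: hmap_ext => y /=; rewrite gK.
  congr (tr _ _); apply: quo_map_ext.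
  by rewrite hcompE fd td orb_proj_base.
have td' d' : t d' = base _ Q -> exists2 h, h \in Q & d' = hs_act (orb K) d h.
  have [B ->] : exists B, d' = f B by exists (g d'); rewrite gK.
  have [h hT ->] := quo_trans B; rewrite !hm_equiv // fd td => e.
  exists h => //; suff : h \in stab (base [set: gT]%G Q) by rewrite stab_base ?subsetT.
  exact/stabP.
have [sQd|nsQd] := boolP (Q \subset stab d).
  rewrite (big_pred1 d) => [|d' /=]; last first.
    apply/eqP/eqP => [/td'[h Qh ->]|->] //.
    by have /stabP[] := subsetP sQd h Qh.
  rewrite (markE sQd) (tr_bij (g := orb_proj sQd)).
  - by rewrite rs_comp; congr (orb_mark (rs _ _)); apply: quo_map_ext;
       rewrite hcompE orb_proj_base fd pt_map_base.
  - have e : hcomp (orb_proj sQd) (orb_proj sdQ) = hid _.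
      by apply: quo_map_ext; rewrite hcompE !orb_proj_base.
    by move=> B; rewrite -hcompE e.
  have e : hcomp (orb_proj sdQ) (orb_proj sQd) = hid _.
    by apply: quo_map_ext; rewrite hcompE !orb_proj_base.
  by move=> B; rewrite -hcompE e.
rewrite big1 => [|d' /eqP/td'[h Qh ->]]; last first.
  apply: mark0; apply: contra nsQd.
  by rewrite stab_act ?inE // -{1}(conjGid Qh) conjSg.
have [U [V ->]] := bt_gen (rs f x).
have trE S : tr (orb_proj sdQ) (bt_cl A S) = bt_cl A (ind_hset Q S).
  by have := bt_tr A sdQ S; rewrite tb_mapE.
by rewrite trB !trE orb_markB !ind_nofix.
Qed.

Lemma mark_tr (Q : {group gT}) D Z (t : hmap D Z) (z : Z) (x : A D) :
  mark Q z (tr t x) = \sum_(d | t d == z) mark Q d x.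
Proof.
have [s|ns] := boolP (Q \subset stab z); last first.
  rewrite mark0 // big1 // => d /eqP td; apply: mark0; apply: contra ns => s.
  by rewrite -td; apply: subset_trans s (stab_mapH _ _).
rewrite (markE s) (rs_tr _ (pullP t (pt_map s))) orb_mark_tr.
(* The point d of the fibre over z is the point (d, base) of the pullback. *)
pose h' d : option (pull t (pt_map s)) := insub (d, base _ Q).
rewrite [RHS](reindex_omap (pull1 t (pt_map s)) h') => [|d /eqP td]; last first.
  have tds : agree t (pt_map s) (d, base _ Q) by apply/eqP; rewrite [RHS]pt_map_base.
  by rewrite /h' (insubT (fun w => agree t (pt_map s) w) tds).
apply: eq_big => [w|w /eqP ew].
  have [c _ _] := pullP t (pt_map s); rewrite c /h'.
  apply/eqP/andP => [ew|[_ /eqP]].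
    by rewrite ew pt_map_base eqxx -ew; split=> //;
       rewrite -[in X in X == _]surjective_pairing valK.
  by case: insubP => // w' _ ew' [<-]; rewrite /= ew'.
have [sw|nsw] := boolP (Q \subset stab w); first by rewrite mark_rs.
rewrite !mark0 //; apply: contra nsw => sw1; apply/subsetP=> q Qq.
have /stabP[qT e1] := subsetP sw1 q Qq.
have /stabP[_ e2] : q \in stab (pull2 _ _ w).
  by rewrite ew (subsetP (sub_stab_base (subxx Q))).
apply/stabP; split=> //; have [_ i _] := pullP t (pt_map s).
by apply: i; rewrite hm_equiv.
Qed.

Lemma fixn_res (H K Q : {group gT}) (s : K \subset H) (X : hset H) :
  fixn (res_hset s X) Q = fixn X Q.
Proof. by []. Qed.

Lemma rs_proj_cl (H K : {group gT}) (s : K \subset H) (X : hset H) :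
  rs (orb_proj s) (bt_cl A X) = bt_cl A (res_hset s X).
Proof. by have := bt_res A s X; rewrite tb_mapE. Qed.

(** Over an orbit this is Burnside's theorem, applied to the two sides of an
    equality of differences; the general case follows by splitting Z into
    orbits. *)
Lemma mark_inj Z (a b : A Z) : (forall Q (z : Z), mark Q z a = mark Q z b) -> a = b.
Proof.
move: Z a b; apply: hset_ind => [X Y [f bf] IH a b e|a b _|X Y IX IY a b e|H _ a b e].
- have [g [fK gK]] := hmap_inv bf.
  have gE (c : A Y) : rs g (rs f c) = c.
    by rewrite rs_comp -[RHS]rs_id; congr rs; apply: hmap_ext => y; rewrite hcompE gK.
  rewrite -[a]gE -[b]gE; congr rs; apply: IH => Q x.
  have [s|s] := boolP (Q \subset stab x); last by rewrite !mark0.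
  by rewrite !mark_rs.
- exact: tb_empty.
- apply: rs_sum_inj; [apply: IX | apply: IY] => Q x;
    (have [s|s] := boolP (Q \subset stab x); last by rewrite !mark0);
    by rewrite !mark_rs.
have [X [Y ea]] := bt_gen a; have [X' [Y' eb]] := bt_gen b.
have markH (Q : {group gT}) (U V : hset H) : Q \subset H ->
    mark Q (base _ H) (bt_cl A U - bt_cl A V) = (fixn U Q)%:Z - (fixn V Q)%:Z.
  move=> s; rewrite (markE (sub_stab_base s)).
  have -> : pt_map (sub_stab_base s) = orb_proj s.
    by apply: quo_map_ext; rewrite pt_map_base orb_proj_base.
  by rewrite rsB !rs_proj_cl orb_markB !fixn_res.
suff : bt_cl A (sum_hset X Y') = bt_cl A (sum_hset X' Y).
  by rewrite !bt_sum ea eb => /eqP; rewrite -subr_eq addrAC eq_sym -subr_eq => /eqP.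
apply/bt_eq; exists (triv_hset H void); apply: hiso_sum; last exact: hiso_refl.
apply: burnside_marks => Q s; rewrite !fixn_sum //.
have /eqP := e Q (base _ H); rewrite ea eb !markH // subr_eq addrAC eq_sym subr_eq.
by rewrite -!PoszD eqz_nat => /eqP.
Qed.
End Marks.

(** * Marks of norms *)

Lemma sum_two_terms (I : finType) (V : nmodType) (P : pred I) (F : I -> V) i j :
  P i -> P j -> j != i -> (forall k, P k -> k != i -> k != j -> F k = 0%R) ->
  (\sum_(k | P k) F k = F i + F j)%R.
Proof.
move=> Pi Pj ji F0; rewrite (bigD1 i) // (bigD1 j) ?Pj //= big1 ?addr0 // => k.
by case/andP=> /andP[]; apply: F0.
Qed.

Section FixedSections.
Variables (gT : finGroupType) (A : burnside gT) (P Q : {group gT}).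
Hypothesis sPQ : P \subset Q.
Local Notation n := (orb_proj sPQ).
Local Notation baseP := (base [set: gT]%G P).
Local Notation baseQ := (base [set: gT]%G Q).

Lemma base_fixed (K : {group gT}) h : h \in K -> hs_act (orb K) (base _ K) h = base _ K.
Proof.
move=> Kh; have /stabP[] // : h \in stab (base [set: gT]%G K).
by rewrite stab_base ?subsetT.
Qed.

Section OneSection.
Variables (B : gset gT) (t : hmap B (orb P)) (sg : hmap (orb P) B).
Hypothesis sgK : cancel sg t.
Local Notation bN := (bs_N n).
Local Notation bT := (bs_T t).

(** A section sg of t over all of G/P defines a point of the dependent product
    over the base point of G/Q: its restriction to the fibre of n there. This
    point is fixed by Q, and every Q-fixed point over the base point arises in
    this way (fixed_ptP), since Q acts transitively on the fibre. *)
Definition fixed_sec : {ffun orb P -> option B} :=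
  [ffun c => if n c == baseQ then Some (sg c) else None].
Lemma fixed_sec_ok : is_sec (b2 := bN) (b1 := bT) (baseQ, fixed_sec).
Proof.
apply/forallP=> c; rewrite /= ffunE; case: ifP => [nc|/negbT nc] //=.
by apply/eqP/sgK.
Qed.
Definition fixed_pt : comp_Z bN bT := exist (fun u => is_sec u) _ fixed_sec_ok.

Lemma fixed_pt_stab : Q \subset stab fixed_pt.
Proof.
apply/subsetP=> h Qh; apply/stabP; split; rewrite ?inE //.
apply: val_inj; rewrite val_comp_Z_act psec_actE.
congr (_, _); first exact: base_fixed.
apply/ffunP=> c; rewrite !ffunE.
have -> : (n (hs_act (orb P) c h^-1) == baseQ) = (n c == baseQ).
  rewrite hm_equiv ?inE //; apply/eqP/eqP => [e|->].
    by rewrite -[LHS](hs_actKV _ (in_setT h)) e base_fixed.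
  by rewrite base_fixed ?groupV.
by case: ifP => //= _; rewrite -hm_equiv ?inE // hs_actKV ?inE.
Qed.

Let uh := pt_map fixed_pt_stab.

Let uh1 k : (val (uh k)).1 = k.
Proof.
have [g gT' ->] := quo_trans k; rewrite hm_equiv // [uh _]pt_map_base.
by rewrite val_comp_Z_act.
Qed.

Let uh2 c : (val (uh (n c))).2 c = Some (sg c).
Proof.
have [g gT' ->] := quo_trans c; rewrite hm_equiv // orb_proj_base.
rewrite hm_equiv // [uh _]pt_map_base val_comp_Z_act psec_actE ffunE.
by rewrite hs_actK // ffunE orb_proj_base eqxx /= -hm_equiv.
Qed.

Let al_ok c : is_eval (b2 := bN) (b1 := bT) (sg c, c, uh (n c)).
Proof. by rewrite /is_eval uh2. Qed.
Let al_fun c : comp_Y bN bT := exist (fun w => is_eval w) _ (al_ok c).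
Let al_equiv c h : h \in [set: gT]%G ->
  al_fun (hs_act (orb P) c h) = hs_act _ (al_fun c) h.
Proof. by move=> hT; apply: val_inj; rewrite val_comp_Y_act -!hm_equiv. Qed.
Let al := HMap al_equiv.

Let pb : is_pullback al n (bs_n (bs_comp bN bT)) uh.
Proof.
split=> [c|c c' e|w k].
- exact: erefl.
- by have e' := congr1 (fun w : comp_Y bN bT => (val w).1.2) e; rewrite /= in e'.
case: w => -[[b c] u] ev eu; rewrite -[LHS]/u in eu.
have es : (val u).2 c = Some b by apply/eqP.
have nc : n c = k.
  by have := forallP (valP u) c; rewrite es => /andP[/eqP e1 _];
     rewrite -[LHS]/(bs_n bN c) e1 eu uh1.
exists c; split=> //; apply: val_inj => /=.
rewrite eu -nc in es *.
by move: es; rewrite uh2 => -[->].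
Qed.

(** Restricting the middle map of the composite along the Q-fixed point
    gives back n, by the pullback pb, and the first leg becomes sg. *)
Lemma mark_fixed_pt (x : A B) :
  mark Q fixed_pt (nm (bs_n (bs_comp bN bT)) (rs (bs_r (bs_comp bN bT)) x)) =
  orb_mark (nm n (rs sg x)).
Proof.
rewrite (markE fixed_pt_stab) (rs_nm _ pb) rs_comp.
by congr (orb_mark (nm _ (rs _ _))); apply: hmap_ext.
Qed.
End OneSection.

Lemma fixed_ptP (B : gset gT) (t : hmap B (orb P)) (u : comp_Z (bs_N n) (bs_T t)) :
  Q \subset stab u -> (val u).1 = baseQ ->
  exists (sg : hmap (orb P) B) (sgK : cancel sg t), u = fixed_pt sgK.
Proof.
move=> sQ u1; have := forallP (valP u) baseP.
case es : ((val u).2 baseP) => [b|]; last first.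
  by move/negP; case; rewrite u1; apply/eqP/orb_proj_base.
case/andP=> _ /eqP tb.
have act2 h c : h \in Q -> (val u).2 c =
    omap (fun b => hs_act B b h) ((val u).2 (hs_act (orb P) c h^-1)).
  move=> Qh; have /stabP[_ e] := subsetP sQ h Qh.
  by rewrite -[in LHS]e val_comp_Z_act psec_actE ffunE.
have sPb : P \subset stab b.
  apply/subsetP=> h Ph; apply/stabP; split; rewrite ?inE //.
  have := act2 h baseP (subsetP sPQ h Ph).
  by rewrite base_fixed ?groupV // es => -[].
have sgK : cancel (pt_map sPb) t.
  have e : hcomp t (pt_map sPb) = hid _.
    by apply: quo_map_ext; rewrite hcompE pt_map_base.
  by move=> y; rewrite -hcompE e.
exists (pt_map sPb), sgK; apply: val_inj; rewrite [LHS]surjective_pairing u1.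
congr (_, _); apply/ffunP=> c; rewrite ffunE.
have [nc|nnc] := eqVneq (n c) baseQ; last first.
  have := forallP (valP u) c; rewrite u1; case: ((val u).2 c) => // b' /andP[e _].
  by case/negP: nnc; exact: e.
have [g gT' ec] := quo_trans c; rewrite {2}ec hm_equiv // pt_map_base.
have Qg : g \in Q.
  suff : g \in stab baseQ by rewrite stab_base ?subsetT.
  by apply/stabP; split=> //; rewrite -[RHS]nc ec [RHS]hm_equiv // orb_proj_base.
by rewrite (act2 g c Qg) {1}ec hs_actK // es.
Qed.

Lemma fixed_pt_inj (B : gset gT) (t : hmap B (orb P)) (sg sg' : hmap (orb P) B)
    (sgK : cancel sg t) (sgK' : cancel sg' t) :
  fixed_pt sgK = fixed_pt sgK' -> sg baseP = sg' baseP.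
Proof.
move/(congr1 (fun u : comp_Z (bs_N n) (bs_T t) => (val u).2 baseP)).
by rewrite !ffunE orb_proj_base eqxx => -[].
Qed.

(** The norm from P to Q is additive modulo transfers that the mark at Q
    does not see: the only sections of the fold map that Q fixes are the two
    constant ones. *)
Lemma orb_mark_nmD (x y : A (orb P)) :
  (orb_mark (nm n (x + y)) = orb_mark (nm n x) + orb_mark (nm n y))%R.
Proof.
have [c [<- <-]] := rs_pair x y; rewrite -tr_fold nm_tr orb_mark_tr.
have lK : cancel (hinl (orb P) (orb P)) (hfold _) by [].
have rK : cancel (hinr (orb P) (orb P)) (hfold _) by [].
rewrite -(mark_fixed_pt lK) -(mark_fixed_pt rK); apply: sum_two_terms.
- exact/eqP.
- exact/eqP.
- by apply/eqP=> e; have := fixed_pt_inj e.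
move=> u /eqP tu ul ur; apply: mark0; apply/negP=> sQ.
have [sg [sgK eu]] := fixed_ptP sQ tu.
have := sgK baseP; case e : (sg baseP) => [y0|y0] ey.
  have es : sg = hinl _ _ by apply: quo_map_ext; rewrite e -[in RHS]ey.
  by subst sg; case/eqP: ul; rewrite eu (Prop_irrelevance sgK lK).
have es : sg = hinr _ _ by apply: quo_map_ext; rewrite e -[in RHS]ey.
by subst sg; case/eqP: ur; rewrite eu (Prop_irrelevance sgK rK).
Qed.
End FixedSections.

Section NormMarks.
Variables (gT : finGroupType) (A : burnside gT).
Implicit Types X Y Z : gset gT.

(** The Q-fixed points of Map_P(Q, X) are the constant functions at P-fixed
    points. *)
Lemma fixn_coind (P Q : {group gT}) (sPQ : P \subset Q) (X : hset P) :
  fixn (coind_hset Q X) Q = fixn X P.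
Proof.
rewrite !fixnE //; set F := [set f | _].
have fixv (f : coind_hset Q X) x : f \in F -> val f x = val f 1.
  rewrite inE => /subsetP sQ; have /sQ/stabP[Qx /(congr1 val)] := valP x.
  rewrite val_sub_act // mk_hsetE // => /ffunP/(_ 1).
  by rewrite ffunE mulg1 sgvalK.
have inj1 : {in F &, injective (fun f : coind_hset Q X => val f 1)}.
  move=> f g Ff Fg e; apply: val_inj; apply/ffunP=> x.
  by rewrite !(fixv _ x).
rewrite -(card_in_imset inj1); apply: eq_card => x; rewrite [RHS]inE.
apply/imsetP/subsetP => [[f Ff ->] k Pk|sP].
  apply/stabP; split=> //; have /forallP/(_ 1)/forall_inP/(_ k Pk)/eqP <- := valP f.
  by rewrite fixv.
have cok : is_coind ([ffun=> x] : transl_hset Q X).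
  apply/forallP=> y; apply/forall_inP=> k /sP/stabP[_ e].
  by rewrite !ffunE e.
exists (exist (fun f => is_coind f) _ cok); last by rewrite /= ffunE.
rewrite inE; apply/subsetP=> h Qh; apply/stabP; split=> //.
apply: val_inj; rewrite val_sub_act // mk_hsetE //.
by apply/ffunP=> y; rewrite !ffunE.
Qed.

(** Both sides are additive in a, which leaves the class of a P-set X, where
    the norm is Map_P(Q, X). *)
Lemma orb_mark_nm (P Q : {group gT}) (sPQ : P \subset Q) (a : A (orb P)) :
  orb_mark (nm (orb_proj sPQ) a) = orb_mark a.
Proof.
have [X [Y ->]] := bt_gen a.
have nmE S : nm (orb_proj sPQ) (bt_cl A S) = bt_cl A (coind_hset Q S).
  by have := bt_norm A sPQ S; rewrite tb_mapE.
have [_ ->] := morph_add0 (@orb_mark_nmD _ A _ _ sPQ).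
by rewrite !nmE !orb_mark_cl !fixn_coind // orb_markB.
Qed.

Variables (e : A (pt gT)) (p : {group gT} -> bool).
Hypothesis orb_mark_e : forall Q : {group gT},
  orb_mark (rs (to_pt (orb Q)) e) = (p Q)%:R%R.
Definition eres X : A X := rs (to_pt X) e.

Lemma rs_eres X Y (f : hmap X Y) : rs f (eres Y) = eres X.
Proof. by rewrite /eres rs_comp; congr rs; apply: hmap_ext. Qed.

Lemma mark_eres (Q : {group gT}) Z (z : Z) : Q \subset stab z ->
  mark Q z (eres Z) = (p Q)%:R%R.
Proof. by move=> s; rewrite (markE s) rs_eres orb_mark_e. Qed.

Lemma nm_bij_eres X Y Z (f : hmap X Y) (n : hmap Y Z) : bijective f ->
  nm n (eres Y) = nm (hcomp n f) (eres X).
Proof.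
move=> /hmap_inv[g [fK gK]]; rewrite -nm_comp (nm_bij _ fK gK); congr nm.
by rewrite rs_eres.
Qed.

Lemma orb_mark_nm_eres_orb (Q K : {group gT}) (n : hmap (orb K) (orb Q)) (d : orb K) :
  n d = base _ Q -> orb_mark (nm n (eres (orb K))) = (p (stab d))%:R%R.
Proof.
move=> nd; have [g [fK gK]] := pt_map_orb d.
have sdQ : stab d \subset Q.
  by have := stab_mapH n d; rewrite nd stab_base // subsetT.
rewrite (nm_bij_eres n (Bijective fK gK)) -orb_mark_e -(orb_mark_nm sdQ).
congr (orb_mark (nm _ _)); apply: quo_map_ext.
by rewrite hcompE pt_map_base nd orb_proj_base.
Qed.

(** Decomposing Y into orbits turns the norm into a product with one factor for
    each orbit. On the orbit of a point d over the base point, n is up to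
    isomorphism the projection from the orbit of stab d. *)
Lemma orb_mark_nm_eres (Q : {group gT}) Y (n : hmap Y (orb Q)) :
  orb_mark (nm n (eres Y)) = [forall y, (n y == base _ Q) ==> p (stab y)]%:R%R.
Proof.
move: Y n; apply: hset_ind => [X Y [f bf] IH n|n|X Y IX IY n|K _ n].
- rewrite (nm_bij_eres n bf) IH; congr (nat_of_bool _)%:R%R.
  apply/forallP/forallP => np y; last first.
    by rewrite -(stab_inj y (bij_inj bf)); apply: np.
  by have [g fK gK] := bf; rewrite -[y]gK (stab_inj _ (bij_inj bf)); apply: np.
- have -> : n = from_void _ by apply: hmap_ext => -[].
  by rewrite nm_void orb_mark1; case: forallP => // -[] [].
- rewrite nm_sum orb_markM !rs_eres IX IY -natrM mulnb; congr (nat_of_bool _)%:R%R.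
  have lI : injective (hinl X Y) by move=> ? ? [].
  have rI : injective (hinr X Y) by move=> ? ? [].
  apply/andP/forallP => [[/forallP nl /forallP nr] [y|y]|np].
  + by rewrite (stab_inj y lI); apply: nl.
  + by rewrite (stab_inj y rI); apply: nr.
  split; apply/forallP=> y.
  + by rewrite -(stab_inj y lI); apply: np.
  by rewrite -(stab_inj y rI); apply: np.
have [k kT ek] := quo_trans (n (base _ K)).
have nd : n (hs_act (orb K) (base _ K) k^-1) = base _ Q.
  by rewrite hm_equiv ?inE // ek hs_actK.
rewrite (orb_mark_nm_eres_orb nd); congr (nat_of_bool _)%:R%R.
apply/idP/forallP => [pd y|/(_ _)/implyP-> //]; last exact/eqP.
apply/implyP=> /eqP ny; have := orb_mark_nm_eres_orb ny.
by rewrite (orb_mark_nm_eres_orb nd) pd; case: (p _).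
Qed.

(** The previous formula, pulled back along the map from the orbit of Q that
    classifies z: the points of the pullback over the base point are the y
    over z, and the stabilizer of y becomes its intersection with Q. *)
Lemma mark_nm_eres (Q : {group gT}) Y Z (n : hmap Y Z) (z : Z) : Q \subset stab z ->
  mark Q z (nm n (eres Y)) = [forall y, (n y == z) ==> p (Q :&: stab y)%G]%:R%R.
Proof.
move=> s; rewrite (markE s) (rs_nm _ (pullP n (pt_map s))) rs_eres orb_mark_nm_eres.
have [c i u] := pullP n (pt_map s); congr (nat_of_bool _)%:R%R.
have stabw w : pull2 n (pt_map s) w = base _ Q ->
    stab w = (Q :&: stab (pull1 n (pt_map s) w))%G.
  move=> ew; apply/group_inj/eqP; rewrite eqEsubset subsetI stab_mapH andbT.
  have := stab_mapH (pull2 n (pt_map s)) w.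
  rewrite ew stab_base ?subsetT // => ->; rewrite andTb.
  apply/subsetP=> h /setIP[Qh /stabP[hT eh]]; apply/stabP; split=> //.
  by apply: i; rewrite hm_equiv // ew base_fixed.
apply/forallP/forallP => np y; apply/implyP=> /eqP ey.
  have [w [<- ew]] : exists w,
      pull1 n (pt_map s) w = y /\ pull2 n (pt_map s) w = base _ Q.
    by apply: u; rewrite ey pt_map_base.
  by rewrite -stabw //; apply: (implyP (np w)); apply/eqP.
rewrite stabw //; apply: (implyP (np _)).
by rewrite c ey pt_map_base.
Qed.
End NormMarks.

(** * Solvable residuals of subgroups *)

Section SolvableResidual.
Variable gT : finGroupType.
Implicit Types H K L P Q : {group gT}.

(* The solvable residual is the stable term of the derived series. *)
Lemma Osolv_der Q : exists n, forall m, n <= m -> Osolv Q = Q^`(m).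
Proof.
have [nO sO] := Osolv_solvable Q; have /derivedP[n e] := sO.
have sn : Q^`(n) \subset Osolv Q.
  rewrite -quotient_sub1; first by rewrite quotient_der ?normal_norm ?e.
  exact: subset_trans (der_sub _ _) (normal_norm nO).
exists n => m lnm; apply/eqP; rewrite eqEsubset; apply/andP; split.
  apply: Osolv_sub; first exact: der_normal.
  apply/derivedP; exists m; rewrite -quotient_der ?normal_norm ?der_normal //.
  by rewrite trivg_quotient.
exact: subset_trans (der_sub_le Q lnm) sn.
Qed.

Lemma der_add Q m n : Q^`(m + n) = Q^`(m)^`(n).
Proof. by elim: n => [|n IH]; rewrite ?addn0 // addnS !dergSn IH. Qed.

Lemma OsolvJ Q g : Osolv (Q :^ g)%G = Osolv Q :^ g.
Proof.
have [m em] := Osolv_der Q; have [n en] := Osolv_der (Q :^ g)%G.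
by rewrite (em (maxn m n)) ?leq_maxl // (en (maxn m n)) ?leq_maxr // derJ.
Qed.

(** A subgroup that contains the solvable residual of Q has the same one: the
    derived series of Q passes through it and is stationary there. *)
Lemma Osolv_between P Q : Osolv Q \subset P -> P \subset Q -> Osolv P = Osolv Q.
Proof.
have [m em] := Osolv_der Q; have [n en] := Osolv_der P => sOP sPQ.
pose k := maxn m n; have mk := leq_maxl m n; have nk := leq_maxr m n.
rewrite (en k nk); apply/eqP; rewrite eqEsubset {1}(em k mk) dergS //=.
rewrite (em (k + k)) ?(leq_trans mk) ?leq_addr // der_add.
by apply: dergS; rewrite /= -(em k mk).
Qed.
End SolvableResidual.

(** * The admissible sets form an indexing system *)

Section Admissible.
Variables (gT : finGroupType) (L : {group gT}).
Implicit Types H K : {group gT}.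

(** Admissible H-sets are those on which every conjugate of L that lies in H
    acts trivially, a form in which the closure properties are immediate. *)
Lemma admP H (X : hset H) : admissible L X <->
  forall (x : X) g a, L :^ g \subset H -> a \in L :^ g -> hs_act X x a = x.
Proof.
split=> [aX x g a sH La|aX x g sH].
  by have /stabP[] := subsetP (aX x g sH) a La.
by apply/subsetP=> a La; apply/stabP; rewrite (subsetP sH) // (aX _ g).
Qed.

Lemma adm_iso H (X Y : hset H) : hiso X Y -> admissible L X -> admissible L Y.
Proof.
case=> f [g fK gK] /admP aX; apply/admP=> y k a sH La.
by rewrite -{1}[y]gK -hm_equiv ?(subsetP sH) // (aX _ k) // gK.
Qed.

Lemma adm_res H K (sKH : K \subset H) (X : hset H) :
  admissible L X -> admissible L (res_hset sKH X).
Proof.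
move=> /admP aX; apply/admP=> x g a sK La.
by apply: (aX x g a _ La); apply: subset_trans sK sKH.
Qed.

Lemma adm_conj H g (X : hset H) : admissible L X -> admissible L (conj_hset g X).
Proof.
move=> /admP aX; apply/admP=> x k a sH La.
rewrite mk_hsetE ?(subsetP sH) // /conj_op; apply: (aX x (k * g^-1)).
  by rewrite conjsgM sub_conjgV.
by rewrite conjsgM memJ_conjg.
Qed.

Lemma adm_triv H (T : finType) : admissible L (triv_hset H T).
Proof. by apply/admP=> x g a sH La; rewrite mk_hsetE ?(subsetP sH). Qed.

Lemma adm_sum H (X Y : hset H) :
  admissible L X -> admissible L Y -> admissible L (sum_hset X Y).
Proof.
move=> /admP aX /admP aY; apply/admP=> -[x|y] g a sH La.
  by rewrite mk_hsetE ?(subsetP sH) //= (aX _ g).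
by rewrite mk_hsetE ?(subsetP sH) //= (aY _ g).
Qed.

Lemma adm_lim H (J E : finType) (D : J -> hset H) (s t : E -> J)
    (f : forall a, hmap (D (s a)) (D (t a))) :
  (forall j, admissible L (D j)) -> admissible L (lim_hset f).
Proof.
move=> aD; apply/admP=> u g a sH La; apply: val_inj.
rewrite val_lim_act ?(subsetP sH) //; apply/ffunP=> j; rewrite ffunE.
by have /admP aDj := aD j; rewrite (aDj _ g).
Qed.

(* A conjugate of L in H acts trivially on H/K, hence lies in every conjugate
   of K, and acts on each summand of the induced set through K. *)
Lemma adm_ind H K (X : hset K) : K \subset H ->
  admissible L (quo H K) -> admissible L X -> admissible L (ind_hset H X).
Proof.
move=> sKH aQ /admP aX; apply/admP=> -[S uS] g a sH La.
have Ha := subsetP sH a La; apply: val_inj; rewrite mk_hsetE // val_ind_op //=.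
case/existsP: (uS) => x /existsP[h /andP[Hh /eqP->]]; rewrite ind_shift_cls.
have sgh : L :^ (g * h^-1) \subset H by rewrite conjsgM sub_conjgV (conjGid Hh).
have sgK : L :^ (g * h^-1) \subset K.
  by have := aQ (base H K) _ sgh; rewrite stab_base.
have Lb : a ^ h^-1 \in L :^ (g * h^-1) by rewrite conjsgM memJ_conjg.
have Kb := subsetP sgK _ Lb.
have xb : hs_act X x (a ^ h^-1) = x by apply: (aX x _ _ sgK).
have eb : h * a = a ^ h^-1 * h by rewrite conjgE invgK !mulgA mulgKV.
rewrite eb; apply/setP=> w; apply/imsetP/imsetP => -[k Kk ->].
  exists ((a ^ h^-1)^-1 * k); first by rewrite groupM ?groupV.
  have xbV : hs_act X x (a ^ h^-1)^-1 = x by rewrite -{1}xb hs_actK.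
  by rewrite hs_actM ?groupV // xbV invMg invgK mulgA.
exists (a ^ h^-1 * k); first by rewrite groupM.
by rewrite hs_actM // xb invMg -mulgA mulKg.
Qed.

Definition adm_system : indexing_system gT :=
  IndexingSystem adm_iso adm_res adm_conj adm_triv adm_sum adm_lim adm_ind.
End Admissible.

(** * Localization at an idempotent *)

(* Inverting an idempotent x is passing to the factor x R. *)
Section LocIdempotent.
Variables (R : comPzRingType) (x : R).
Hypothesis xx : (x * x = x)%R.
Local Open Scope ring_scope.

Lemma idem_exp n : x * x ^+ n = x.
Proof. by elim: n => [|n IH]; rewrite ?expr0 ?mulr1 // exprS mulrCA IH. Qed.

Lemma lfrac_idem (a b : R) m n : lfrac x (a, m) = lfrac x (b, n) <-> x * a = x * b.
Proof.
split=> [/eqP/lfracP[k /= e]|e].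
  by move/(congr1 ( *%R x)): e; rewrite !mulrA !idem_exp.
by apply/eqP/lfracP; exists 1%N; rewrite /= !exprD expr1 !idem_exp.
Qed.
End LocIdempotent.

(** A map of Tambara functors is multiplicative, products being norms along the
    fold maps. *)
Lemma tb_homM (gT : finGroupType) (I : indexing_system gT) (A C : tambara I)
    (f : forall X, A X -> C X) : tb_hom f ->
  forall X (x y : A X), f X (x * y)%R = (f X x * f X y)%R.
Proof.
move=> fh X x y; have [g _ gK] := tb_prod A X X.
by have := gK (x, y); set c := g _ => -[<- <-]; rewrite -tb_mul fh tb_mul !fh.
Qed.

Section Localization.
Variables (gT : finGroupType) (A : burnside gT) (e : A (pt gT)) (L : {group gT}).
Let p (Q : {group gT}) := Osolv Q \in L :^: [set: gT].
Hypothesis orb_mark_e : forall Q : {group gT},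
  orb_mark (rs (to_pt (orb Q)) e) = (p Q)%:R%R.
Hypothesis perfL : perfect L.
Implicit Types X Y Z W : gset gT.
Local Open Scope ring_scope.
Local Notation IL := (adm_system L).
Local Notation eres := (eres e).

(* The marks are 0 or 1. *)
Lemma eres_idem X : eres X * eres X = eres X.
Proof.
apply: mark_inj => Q z; rewrite markM.
have [s|s] := boolP (Q \subset stab z); last by rewrite mark0 ?mul0r.
by rewrite (mark_eres orb_mark_e) // -natrM mulnb andbb.
Qed.

Lemma eres_pt : eres (pt gT) = e.
Proof.
have pt1 (z : pt gT) : z = base _ _.
  by have [h hT ->] := quo_trans z; rewrite base_fixed.
rewrite -[RHS]rs_id; congr rs; apply: hmap_ext => z.
by rewrite [LHS]pt1 [RHS]pt1.
Qed.

(** Frobenius reciprocity, read off from the marks of transfers *)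
Lemma frobenius X Y (f : hmap X Y) (x : A X) (y : A Y) :
  tr f (x * rs f y) = tr f x * y.
Proof.
apply: mark_inj => Q z; rewrite markM !mark_tr mulr_suml.
apply: eq_bigr => d /eqP <-; rewrite markM.
have [s|s] := boolP (Q \subset stab d); first by rewrite mark_rs.
by rewrite !(mark0 _ s) !mul0r.
Qed.

Lemma residual_conj (Q : {group gT}) : p Q -> exists g, Osolv Q = L :^ g.
Proof. by case/imsetP=> g _ ->; exists g. Qed.

Lemma residual_L g : p (L :^ g)%G.
Proof. by rewrite /p OsolvJ perfL; apply/imsetP; exists g; rewrite ?inE. Qed.

(** Norms along admissible maps of the idempotent restrict to 1 on the part that
    the idempotent cuts out: a subgroup Q with solvable residual conjugate to L
    fixing a point z has its residual in the stabilizer of every point y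
    over z, so Q and its subgroup that fixes y have the same residual. *)
Lemma eres_nm Y Z (n : hmap Y Z) : in_Set IL n -> eres Z * nm n (eres Y) = eres Z.
Proof.
move=> In; apply: mark_inj => Q z; rewrite markM.
have [s|s] := boolP (Q \subset stab z); last by rewrite !(mark0 _ s) mul0r.
rewrite (mark_nm_eres orb_mark_e) // (mark_eres orb_mark_e) // -natrM mulnb.
congr (nat_of_bool _)%:R; apply: andb_idr => pQ; apply/forallP=> y.
apply/implyP=> /eqP ny; have [g eg] := residual_conj pQ.
have sO : Osolv Q \subset Q by have [/andP[]] := Osolv_solvable Q.
have := In y (base _ _) g; rewrite stab_base ?stab_map // => sy.
rewrite /p (Osolv_between _ (subsetIl _ _)) // subsetI sO /= eg; apply: sy.
by rewrite -eg ny; apply: subset_trans sO s.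
Qed.

(** Restrictions, norms along admissible maps, and transfers descend to the
    localization: by Frobenius reciprocity and eres_nm the idempotent can be
    moved from the target through the bispan to the source. *)
Lemma eres_brun X W (b : bispan X W) (x y : A X) : in_Set IL (bs_n b) ->
  eres X * x = eres X * y -> eres W * brun b x = eres W * brun b y.
Proof.
move=> Ib exy; suff red z : eres W * brun b z =
    tr (bs_t b) (eres _ * nm (bs_n b) (rs (bs_r b) (eres X * z))).
  by rewrite !red exy.
rewrite brunE mulrC -frobenius rs_eres rsM rs_eres nmM mulrA eres_nm //.
by rewrite mulrC.
Qed.

Let eX X : A X := tb_map (ib_R (full_indexing gT) (to_pt X)) e.
Let eXE X : eX X = eres X.
Proof. by rewrite /eX tb_mapE. Qed.
Let eX_idem X : eX X * eX X = eX X.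
Proof. by rewrite eXE eres_idem. Qed.

Notation can := (loc_can e).

Lemma lfrac_can X a n : lfrac (eX X) (a, n) = can a.
Proof. exact: (lfrac_idem (eX_idem X) _ _ _ _).2. Qed.

Lemma can_lrep X (q : loc_ob e X) : can (lrep q).1 = q.
Proof. by rewrite -[RHS]lrepK; case: (lrep q) => a n; rewrite lfrac_can. Qed.

Lemma can_surj X (q : loc_ob e X) : exists a, q = can a.
Proof. by exists (lrep q).1; rewrite can_lrep. Qed.

Lemma can_eq X (a b : A X) : can a = can b <-> eres X * a = eres X * b.
Proof. by rewrite -eXE; apply: lfrac_idem. Qed.

Lemma canD X (a b : A X) : can (a + b) = can a + can b.
Proof. by rewrite [RHS]laddE /= expr0 !mul1r. Qed.

Lemma canM X (a b : A X) : can (a * b) = can a * can b.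
Proof. by rewrite [RHS]lmulE. Qed.

Lemma can_eres X : can (eres X) = 1.
Proof. by rewrite -[1]/(can 1); apply/can_eq; rewrite mulr1 eres_idem. Qed.

(** The choice of a representative is harmless for bispans with admissible
    middle map, by eres_brun. *)
Definition loc_run X W (b : bispan X W) (q : loc_ob e X) : loc_ob e W :=
  can (brun b (lrep q).1).

Lemma loc_runE X W (b : bispan X W) (a : A X) : in_Set IL (bs_n b) ->
  loc_run b (can a) = can (brun b a).
Proof.
by move=> Ib; apply/can_eq/eres_brun => //; apply/can_eq/can_lrep.
Qed.

Section Tambara.
Let map X Y (b : ibispan IL X Y) := loc_run b.
Let mapE X Y (b : ibispan IL X Y) a : map b (can a) = can (brun b a).
Proof. by apply: loc_runE; apply: ib_in. Qed.

Let map_iso X Y (b b' : ibispan IL X Y) : bispan_iso b b' -> map b =1 map b'.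
Proof. by move=> bb' q; have [a ->] := can_surj q; rewrite !mapE (brun_iso bb'). Qed.

Let map_id X : map (ib_id IL X) =1 id.
Proof. by move=> q; have [a ->] := can_surj q; rewrite mapE [brun _ a]rs_id. Qed.

Let map_comp X Y Z (b2 : ibispan IL Y Z) (b1 : ibispan IL X Y) :
  map (ib_comp b2 b1) =1 map b2 \o map b1.
Proof. by move=> q; have [a ->] := can_surj q; rewrite /= !mapE brun_comp. Qed.

Let map_empty (q r : loc_ob e (triv_hset [set: gT]%G void)) : q = r.
Proof.
have [a ->] := can_surj q; have [b ->] := can_surj r; congr (can _).
exact: tb_empty.
Qed.

Let map_prod X Y : bijective (fun q : loc_ob e (sum_hset X Y) =>
  (map (ib_R IL (hinl X Y)) q, map (ib_R IL (hinr X Y)) q)).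
Proof.
apply: inj_surj_bij => [q r|[q r]].
  have [a ->] := can_surj q; have [b ->] := can_surj r; rewrite !mapE.
  case=> /can_eq el /can_eq er; apply/can_eq/rs_sum_inj; rewrite !rsM !rs_eres.
    exact: el.
  exact: er.
have [a ->] := can_surj q; have [b ->] := can_surj r.
have [c [<- <-]] := rs_pair a b.
by exists (can c); rewrite !mapE.
Qed.

Let map_add X (q : loc_ob e (sum_hset X X)) :
  map (ib_T IL (hfold X)) q = map (ib_R IL (hinl X X)) q + map (ib_R IL (hinr X X)) q.
Proof.
have [c ->] := can_surj q; rewrite !mapE -canD; congr (can _).
exact: tr_fold.
Qed.

Let map_mul X (q : loc_ob e (sum_hset X X)) :
  map (ib_N (@in_Set_fold _ IL X)) q =
  map (ib_R IL (hinl X X)) q * map (ib_R IL (hinr X X)) q.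
Proof.
have [c ->] := can_surj q; rewrite !mapE -canM; congr (can _).
exact: nm_fold.
Qed.

Definition loc_tambara : tambara IL :=
  @Tambara gT IL (loc_ob e) map map_iso map_id map_comp map_empty map_prod
    map_add map_mul.
End Tambara.

Lemma loc_tambara_structure :
  loc_structure (ix_le_full IL) (B := loc_tambara) (fun X => @loc_can _ _ _ e X)
    (fun X => idfun : {rmorphism loc_tambara X -> loc_ob e X}).
Proof.
split=> [X|X Y f q|X Y f q|X Y b a|X a] //.
- by exists id.
- apply: etrans (esym (lfrac_can _ (lrep q).2)); congr (can _).
  exact: esym (tb_mapE (ib_R (full_indexing gT) f) _).
- apply: etrans (esym (lfrac_can _ (lrep q).2)); congr (can _).
  exact: esym (tb_mapE (ib_T (full_indexing gT) f) _).
apply: etrans (esym (loc_runE a (@ib_in _ _ _ _ b))).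
by congr (can _); apply: tb_mapE.
Qed.

(** If the localization has norms along H/K, the norm of the idempotent from K to
    H becomes 1 in it, since the idempotent itself does. So at a conjugate Q
    of L in H the mark of this norm is 1. But this mark is 0 unless Q meets K
    in a group with solvable residual conjugate to L, that is, unless Q lies
    in K. *)
Lemma loc_structure_adm (J : indexing_system gT) :
  has_loc_structure e (ix_le_full J) -> ix_le J IL.
Proof.
case=> B [eta [theta [bij_th _ _ eta_hom eta_can]]] H X JX x g sLH.
set K := stab x; have sKH : K \subset H by apply: subsetIl.
have JHK : J H (quo H K) := ix_orbit x JX.
have inJ : in_Set J (orb_proj sKH).
  move=> y; have [h hT ->] := quo_trans y.
  rewrite hm_equiv // orb_proj_base.
  rewrite !stab_act // !stab_base ?subsetT //.
  have := @ix_orbit _ J _ (conj_hset h (quo H K)) (base H K) (ix_conj h JHK).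
  by rewrite stab_conj_hset stab_base.
have eta1 : eta (orb K) (eres (orb K)) = eta (orb K) 1.
  by apply: (bij_inj (bij_th _)); rewrite !eta_can can_eres.
have etaN a : eta (orb H) (nm (orb_proj sKH) a) = tb_map (ib_N inJ) (eta (orb K) a).
  by rewrite -eta_hom /= tb_mapE.
have /can_eq : can (nm (orb_proj sKH) (eres (orb K))) = can 1.
  by rewrite -!eta_can etaN eta1 -etaN nm1.
move/(congr1 (mark (L :^ g)%G (base _ H))).
have sLb : (L :^ g)%G \subset stab (base [set: gT]%G H) by rewrite stab_base ?subsetT.
rewrite mulr1 markM (mark_nm_eres orb_mark_e) // (mark_eres orb_mark_e) //.
rewrite residual_L mul1r.
case: forallP => // /(_ (base _ K)); rewrite orb_proj_base eqxx /= stab_base ?subsetT //.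
move=> pI _; have [k ek] := residual_conj pI.
have sO : L :^ k \subset (L :^ g :&: K)%G.
  by rewrite -ek; have [/andP[]] := Osolv_solvable (L :^ g :&: K)%G.
suff -> : L :^ g = (L :^ g :&: K)%G by apply: subsetIr.
apply/esym/eqP; rewrite eqEcard subsetIl cardJg -(cardJg L k).
exact: subset_leq_card sO.
Qed.

(** An idempotent that becomes a unit becomes 1, so a map out of A that inverts
    e identifies elements with the same image in the localization, and
    descends along the surjection eta. *)
Lemma loc_structure_universal (B : tambara IL) (eta : forall X, A X -> B X)
    (theta : forall X, {rmorphism B X -> loc_ob e X}) :
  loc_structure (ix_le_full IL) eta theta ->
  is_tb_localization (A := tb_forget (ix_le_full IL) A) e eta.
Proof.
case=> bij_th _ _ eta_hom eta_can; split=> //.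
  exists 1; rewrite mulr1; apply: (bij_inj (bij_th _)); rewrite eta_can rmorph1.
  by rewrite -[RHS]can_eres; congr (can _); rewrite eres_pt.
move=> C f f_hom [y fey].
have fM X := tb_homM f_hom (X := X).
have fe : f (pt gT) e = f (pt gT) 1.
  have fe1 a : f (pt gT) (e * a) = f (pt gT) e -> f (pt gT) a = 1.
    by move/(congr1 ( *%R y)); rewrite fM mulrA ![y * _]mulrC fey mul1r.
  by rewrite (fe1 e) ?(fe1 1) ?mulr1 // -eres_pt eres_idem.
have fu X : f X (eres X) = f X 1.
  have fR a : f X (rs (to_pt X) a) = tb_map (ib_R IL (to_pt X)) (f (pt gT) a).
    by rewrite -f_hom /= tb_mapE.
  by rewrite /eres fR fe -fR rs1.
have f_can X a b : can a = can b -> f X a = f X b.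
  move/can_eq/(congr1 (f X)); rewrite !fM fu -!fM.
  by rewrite !mul1r.
pose g X b := f X (lrep (theta X b)).1.
have g_eta X a : g X (eta X a) = f X a.
  by apply: f_can; rewrite can_lrep eta_can.
have eta_surj X b : exists a, b = eta X a.
  have [a ea] := can_surj (theta X b); exists a.
  by apply: (bij_inj (bij_th _)); rewrite eta_can.
exists g; split=> // [X Y b q|g' _ g'_eta X b].
  by have [a ->] := eta_surj X q; rewrite -eta_hom !g_eta f_hom.
by have [a ->] := eta_surj X b; rewrite g_eta g'_eta.
Qed.
End Localization.

Lemma orb_mark_phi (gT : finGroupType) (A : burnside gT) (Q : {group gT})
    (phi : {rmorphism A (pt gT) -> int}) (x : A (pt gT)) :
  is_mark Q phi -> orb_mark (rs (to_pt (orb Q)) x) = phi x.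
Proof.
move=> hphi; have [X [Y ->]] := bt_gen x.
have -> : to_pt (orb Q) = orb_proj (subsetT Q).
  by apply: quo_map_ext; rewrite orb_proj_base.
by rewrite rsB !rs_proj_cl orb_markB !fixn_res rmorphB /= !hphi.
Qed.

Theorem theoremD (gT : finGroupType) (A : burnside gT)
    (phi : {group gT} -> {rmorphism A (pt gT) -> int})
    (hphi : forall Q, is_mark Q (phi Q))
    (L : {group gT}) (hL : perfect L) (e : A (pt gT))
    (he : forall Q, phi Q e = (Osolv Q \in L :^: [set: gT])%:R%R) :
  exists IL : indexing_system gT,
    [/\ forall (H : {group gT}) (X : hset H), IL H X <-> admissible L X,
        has_loc_structure e (ix_le_full IL),
        forall J : indexing_system gT,
          has_loc_structure e (ix_le_full J) -> ix_le IL J -> ix_le J IL &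
        forall (B : tambara IL) (eta : forall X, A X -> B X)
               (theta : forall X, {rmorphism B X -> loc_ob e X}),
          loc_structure (ix_le_full IL) eta theta ->
          is_tb_localization (A := tb_forget (ix_le_full IL) A) e eta].
Proof.
have orb_mark_e (Q : {group gT}) :
    orb_mark (rs (to_pt (orb Q)) e) = (Osolv Q \in L :^: [set: gT])%:R%R.
  by rewrite -he; apply: orb_mark_phi.
exists (adm_system L); split=> //.
- exists (loc_tambara orb_mark_e), (fun X => @loc_can _ _ _ e X).
  exists (fun X => idfun : {rmorphism loc_tambara orb_mark_e X -> loc_ob e X}).
  exact: loc_tambara_structure.
- by move=> J hJ _; apply: (loc_structure_adm orb_mark_e hL).
by move=> B eta theta; apply: loc_structure_universal.
Qed.
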